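(* Suppose $\alpha_1+\alpha_2<1$ and $\nu^{-1}R_iC_p^2<1$. Let $u^0\in X$ be arbitrary and let $(\tilde u^{k+1},\tilde T^{k+1})\in V\times D$ and $(u^{k+1},T^{k+1})\in V\times D$, $k=0,1,2,\dots$, be iterates of the Picard-Newton iteration. Then for every $k\ge 0$, $$(1-\alpha_1-\alpha_2)\|\nabla u^{k+1}\|+(1-\nu^{-1}R_iC_p^2)\|\nabla T^{k+1}\|\le M_2+2M_1 .$$
   Context: Setting. $\Omega\subset\mathbb{R}^d$ ($d=2$ or $3$) is a bounded connected domain, sufficiently regular for the inequalities below, with $\partial\Omega=\Gamma_1\cup\Gamma_2$, $\mathrm{meas}(\Gamma_1\cap\Gamma_2)=0$, $\mathrm{meas}(\Gamma_1)>0$. $(\cdot,\cdot)$ and $\|\cdot\|$ are the $L^2(\Omega)$ inner product and norm (also dual pairings). $X=\{v\in H^1(\Omega)^d: v=0 \text{ on }\partial\Omega\}$, $Q=\{q\in L^2(\Omega):\int_\Omega q=0\}$, $D=\{w\in H^1(\Omega): w=0\text{ on }\Gamma_1\}$, $V=\{v\in X:(\nabla\cdot v,q)=0\ \forall q\in Q\}$; these spaces ($X$, $V$, $D$) are normed by $z\mapsto\|\nabla z\|$. Dual norms: $\|F\|_{V^*}=\sup_{0\ne z\in V}(F,z)/\|\nabla z\|$, and similarly $\|\cdot\|_{D^*}$. $C_p>0$ is a Poincaré constant: $\|z\|\le C_p\|\nabla z\|$ for all $z\in X$ and all $z\in D$. Trilinear forms: $b(u,v,w)=(u\cdot\nabla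 v,w)+\frac12((\nabla\cdot u)v,w)$ for $u,v,w\in X$ and $\hat b(u,s,t)=(u\cdot\nabla s,t)+\frac12((\nabla\cdot u)s,t)$ for $u\in X$, $s,t\in D$; they satisfy $b(u,v,v)=0$, $\hat b(u,s,s)=0$. $C_s>0$ is a constant with $|b(u,v,w)|\le C_s\|\nabla u\|\|\nabla v\|\|\nabla w\|$ and $|\hat b(u,s,t)|\le C_s\|\nabla u\|\|\nabla s\|\|\nabla t\|$. Data: $\nu,\kappa,R_i>0$, $f\in X^*$ (also regarded in $V^*$), $g\in D^*$. For scalar $T$, $(0\ T)^T$ denotes the vector field whose last component is $T$ and whose other components are $0$. Constants: $M_2=\kappa^{-1}\|g\|_{D^*}$, $M_1=\nu^{-1}\|f\|_{V^*}+R_iC_p^2\nu^{-1}M_2$, $\alpha_1=C_s\nu^{-1}M_1$, $\alpha_2=C_s\kappa^{-1}M_2$. Picard-Newton iteration. Given $u^k$: Step 1 (Picard step): $(\tilde u^{k+1},\tilde T^{k+1})\in V\times D$ satisfies, for all $(v,w)\in V\times D$, $b(u^k,\tilde u^{k+1},v)+\nu(\nabla\tilde u^{k+1},\nabla v)=(f,v)+R_i((0\ \tilde T^{k+1})^T,v)$ and $\hat b(u^k,\tilde T^{k+1},w)+\kappa(\nabla\tilde T^{k+1},\nabla w)=(g,w)$. Step 2 (Newton step): $(u^{k+1},T^{k+1})\in V\times D$ satisfies, for all $(v,w)\in V\times D$, $b(u^{k+1},\tilde u^{k+1},v)+b(\tilde u^{k+1},u^{k+1},v)+\nu(\nabla u^{k+1},\nabla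 v)=(f,v)+R_i((0\ T^{k+1})^T,v)+b(\tilde u^{k+1},\tilde u^{k+1},v)$ and $\hat b(u^{k+1},\tilde T^{k+1},w)+\hat b(\tilde u^{k+1},T^{k+1},w)+\kappa(\nabla T^{k+1},\nabla w)=(g,w)+\hat b(\tilde u^{k+1},\tilde T^{k+1},w)$. *)

(* Defs.v *)
From HB Require Import structures.
From mathcomp Require Import all_boot all_order all_algebra.
From mathcomp Require Import all_classical all_reals all_analysis.
Set Implicit Arguments.
Unset Strict Implicit.
Unset Printing Implicit Defensive.
Import Order.TTheory GRing.Theory Num.Theory.
Import numFieldNormedType.Exports.
Local Open Scope classical_set_scope.
Local Open Scope ring_scope.

(* Lebesgue and surface measure on R^d. Both come from a set function
   (a gauge) through the library's [mu_ext], which covers a set by countably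
   many sets of a semiring; here every set is allowed in a cover, a set that
   is not meant to be used having gauge +oo. *)

Definition discrete_type (T : pointedType) := g_sigma_algebraType [set: set T].

Section gauge.
Context (R : realType) (T : pointedType).

Definition gauge_outer (zeta : set T -> \bar R) : set T -> \bar R :=
  @mu_ext _ (discrete_type T) R zeta.

Variable zeta : set T -> \bar R.
Hypothesis zeta0 : zeta set0 = 0%E.
Hypothesis zeta_ge0 : forall A, (0 <= zeta A)%E.

Lemma gauge_outer0 : gauge_outer zeta set0 = 0%E.
Proof. exact: (@mu_ext0 _ (discrete_type T)). Qed.

Lemma gauge_outer_ge0 A : (0 <= gauge_outer zeta A)%E.
Proof. exact: (@mu_ext_ge0 _ (discrete_type T)). Qed.

Lemma le_gauge_outer : {homo gauge_outer zeta : A B / A `<=` B >-> (A <= B)%E}.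
Proof. exact: (@le_mu_ext _ (discrete_type T)). Qed.

Lemma gauge_outer_sigma_subadditive : sigma_subadditive (gauge_outer zeta).
Proof. exact: (@mu_ext_sigma_subadditive _ (discrete_type T)). Qed.

End gauge.

Section lebesgue.
Context (R : realType) (d : nat).
Local Notation E := 'rV[R]_d.

Definition box (a b : E) : set E :=
  [set x | forall i, a ord0 i <= x ord0 i < b ord0 i].

Definition box_gauge (A : set E) : \bar R :=
  if `[< A = set0 >] then 0%E else
  ereal_inf [set (\prod_i (ab.2 ord0 i - ab.1 ord0 i))%:E | ab in
    [set ab : E * E |
      (forall i, ab.1 ord0 i <= ab.2 ord0 i) /\ A = box ab.1 ab.2]].

Lemma box_gauge0 : box_gauge set0 = 0%E.
Proof. by rewrite /box_gauge asboolT. Qed.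

Lemma box_gauge_ge0 A : (0 <= box_gauge A)%E.
Proof.
rewrite /box_gauge; case: ifP => // _.
apply: le_ereal_inf_tmp => _ [ab [ab_le _] <-].
by rewrite lee_fin; apply: prodr_ge0 => i _; rewrite subr_ge0.
Qed.

Definition leb : set E -> \bar R := gauge_outer box_gauge.

HB.instance Definition _ := isOuterMeasure.Build R E leb
  (gauge_outer0 box_gauge0 box_gauge_ge0)
  (gauge_outer_ge0 box_gauge_ge0)
  (@le_gauge_outer R E box_gauge)
  (gauge_outer_sigma_subadditive box_gauge_ge0).

(* [leb] is a measure on this copy of R^d, whose measurable sets are the
   Lebesgue (i.e. Caratheodory) measurable ones. *)
Definition leb_om : {outer_measure set E -> \bar R} := leb.
Definition lebT := caratheodory_type leb_om.
Definition lebm : {measure set lebT -> \bar R} :=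
  (leb_om : set (caratheodory_type leb_om) -> \bar R).

End lebesgue.
Arguments leb {R d}.
Arguments lebm {R d}.

Section hausdorff.
Context (R : realType) (d : nat).
Local Notation E := 'rV[R]_d.

(* The library norm of ['rV_d] is the maximum norm. *)
Definition eucl (x : E) : R := Num.sqrt (\sum_i x ord0 i ^+ 2).

Definition diam (A : set E) : \bar R :=
  ereal_sup [set (eucl (xy.1 - xy.2))%:E | xy in A `*` A].

Definition hausdorff_gauge (s : nat) (delta : R) (A : set E) : \bar R :=
  if `[< A = set0 >] then 0%E else
  if (diam A <= delta%:E)%E then (diam A ^+ s)%E else +oo%E.

Lemma hausdorff_gauge0 s delta : hausdorff_gauge s delta set0 = 0%E.
Proof. by rewrite /hausdorff_gauge asboolT. Qed.

Lemma hausdorff_gauge_ge0 s delta A : (0 <= hausdorff_gauge s delta A)%E.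
Proof.
rewrite /hausdorff_gauge; case: ifPn => // /asboolPn A0.
case: ifP => // _; apply: expe_ge0.
have /set0P[x Ax] : A != set0 by apply/eqP.
apply: le_ereal_sup_tmp; exists (eucl (x - x))%:E; first by exists (x, x).
by rewrite lee_fin sqrtr_ge0.
Qed.

(* s-dimensional Hausdorff outer measure, without the usual constant
   factor, which plays no role below. *)
Definition hausdorff (s : nat) (A : set E) : \bar R :=
  ereal_sup [set gauge_outer (hausdorff_gauge s delta) A | delta in
    [set delta : R | 0 < delta]].

(* (d-1)-dimensional surface measure *)
Definition surf : set E -> \bar R := hausdorff d.-1.

Lemma surf0 : surf set0 = 0%E.
Proof.
rewrite /surf /hausdorff.
rewrite (_ : [set _ | _ in _] = [set 0%E]) ?ereal_sup1//.
have H0 delta : gauge_outer (hausdorff_gauge d.-1 delta) set0 = 0%E.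
  exact: (gauge_outer0 (hausdorff_gauge0 _ _) (hausdorff_gauge_ge0 _ _)).
apply/seteqP; split => [_ [delta _ <-]|_ ->]; first by rewrite H0.
by exists 1; [exact: ltr01|exact: H0].
Qed.

Lemma surf_ge0 A : (0 <= surf A)%E.
Proof.
apply: le_ereal_sup_tmp; exists (gauge_outer (hausdorff_gauge d.-1 1) A).
  by exists 1 => //; exact: ltr01.
exact: (gauge_outer_ge0 (hausdorff_gauge_ge0 _ _)).
Qed.

Lemma le_surf : {homo surf : A B / A `<=` B >-> (A <= B)%E}.
Proof.
move=> A B AB; apply: ge_ereal_sup => _ [delta delta0 <-].
apply: le_ereal_sup_tmp; exists (gauge_outer (hausdorff_gauge d.-1 delta) B).
  by exists delta.
exact: le_gauge_outer.
Qed.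

Lemma surf_sigma_subadditive : sigma_subadditive surf.
Proof.
move=> F; apply: ge_ereal_sup => _ [delta delta0 <-].
apply: (le_trans
  (gauge_outer_sigma_subadditive (hausdorff_gauge_ge0 _ _) _)).
apply: lee_nneseries => [k _ _|k _].
  exact: (gauge_outer_ge0 (hausdorff_gauge_ge0 _ _)).
by apply: ereal_sup_ubound; exists delta.
Qed.

HB.instance Definition _ := isOuterMeasure.Build R E surf
  surf0 surf_ge0 le_surf surf_sigma_subadditive.

Definition surf_om : {outer_measure set E -> \bar R} := surf.
Definition surfT := caratheodory_type surf_om.
Definition surfm : {measure set surfT -> \bar R} :=
  (surf_om : set (caratheodory_type surf_om) -> \bar R).

End hausdorff.
Arguments surf {R d}.
Arguments surfm {R d}.

Section spaces.
Context (R : realType) (d : nat).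
Local Notation E := 'rV[R]_d.
Implicit Types (Omega Gamma : set E) (phi : E -> R).

Definition partial (i : 'I_d) (f : E -> R) : E -> R :=
  fun x => 'D_(delta_mx ord0 i) f x.

Fixpoint Ck (n : nat) (f : E -> R) : Prop :=
  if n is m.+1 then
    [/\ continuous f, forall i x, derivable f x (delta_mx ord0 i)
      & forall i, Ck m (partial i f)]
  else continuous f.

Definition smooth (f : E -> R) : Prop := forall n, Ck n f.

(* C_c^oo(Omega) *)
Definition test_function Omega phi : Prop :=
  smooth phi /\ exists K : set E,
    [/\ compact K, K `<=` Omega & forall x, ~ K x -> phi x = 0].

Definition L2 Omega (f : E -> R) : Prop :=
  measurable_fun (Omega : set (lebT R d)) (f : lebT R d -> R) /\
  (\int[lebm]_(x in Omega) ((f x ^+ 2)%:E) < +oo)%E.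

(* A scalar Sobolev function is carried with its weak gradient: [w.1] is the
   function and [w.2 i] its weak i-th partial derivative. Pairs that agree
   almost everywhere are not identified. A vector field is the family of its
   components. *)
Definition sfield : lmodType R := ((E -> R) * ('I_d -> E -> R))%type.
Definition vfield : lmodType R := ('I_d -> sfield)%type.

Definition H1 Omega : set sfield := [set w |
  [/\ L2 Omega w.1, forall i, L2 Omega (w.2 i)
    & forall i phi, test_function Omega phi ->
        \int[lebm]_(x in Omega) (w.1 x * partial i phi x) =
        - \int[lebm]_(x in Omega) (w.2 i x * phi x)]].

Definition H1_cvg Omega (phi : nat -> E -> R) (w : sfield) : Prop :=
  (fun n => \int[lebm]_(x in Omega)
     ((phi n x - w.1 x) ^+ 2 +
      \sum_i (partial i (phi n) x - w.2 i x) ^+ 2)%:E)%E @ \oo --> 0%E.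

(* H^1_0(Omega): vanishing on the whole boundary *)
Definition H10 Omega : set sfield := [set w | H1 Omega w /\
  exists phi : nat -> E -> R,
    (forall n, test_function Omega (phi n)) /\ H1_cvg Omega phi w].

(* Vanishing on a part Gamma of the boundary. The trace of w on Gamma is the
   limit in L^2(Gamma) of the restrictions to Gamma of functions that are
   smooth up to the boundary and tend to w in H^1(Omega). *)
Definition trace0 Omega Gamma (w : sfield) : Prop :=
  exists phi : nat -> E -> R,
    [/\ forall n, smooth (phi n), H1_cvg Omega phi w &
      (fun n => \int[surfm]_(x in Gamma) ((phi n x ^+ 2)%:E))%E @ \oo --> 0%E].

Definition div (v : vfield) (x : E) : R := \sum_i (v i).2 i x.

Definition X_ Omega : set vfield := [set v | forall j, H10 Omega (v j)].

Definition Q_ Omega : set (E -> R) := [set q |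
  L2 Omega q /\ \int[lebm]_(x in Omega) q x = 0].

Definition D_ Omega Gamma : set sfield := [set w |
  H1 Omega w /\ trace0 Omega Gamma w].

Definition V_ Omega : set vfield := [set v | X_ Omega v /\
  forall q, Q_ Omega q -> \int[lebm]_(x in Omega) (div v x * q x) = 0].

Definition ip_s Omega (s t : E -> R) : R :=
  \int[lebm]_(x in Omega) (s x * t x).

Definition ip_v Omega (u v : 'I_d -> E -> R) : R :=
  \int[lebm]_(x in Omega) (\sum_j u j x * v j x).

(* (grad s, grad t) and (grad u, grad v) *)
Definition ip_grad_s Omega (s t : sfield) : R :=
  \int[lebm]_(x in Omega) (\sum_i s.2 i x * t.2 i x).

Definition ip_grad_v Omega (u v : vfield) : R :=
  \int[lebm]_(x in Omega) (\sum_j \sum_i (u j).2 i x * (v j).2 i x).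

Definition values (v : vfield) : 'I_d -> E -> R := fun j => (v j).1.

Definition norm_s Omega (s : sfield) : R := Num.sqrt (ip_s Omega s.1 s.1).
Definition norm_v Omega (v : vfield) : R :=
  Num.sqrt (ip_v Omega (values v) (values v)).
Definition gnorm_s Omega (s : sfield) : R := Num.sqrt (ip_grad_s Omega s s).
Definition gnorm_v Omega (v : vfield) : R := Num.sqrt (ip_grad_v Omega v v).

(* the vector field (0 T)^T *)
Definition last_component (T : sfield) : 'I_d -> E -> R :=
  fun j x => if j.+1 == d then T.1 x else 0.

(* The trilinear forms take values in \bar R: an integral whose positive and
   negative parts are not both finite is infinite, so that a finite bound on
   [bE] or [bhatE] includes the integrability of the integrands, while [fine]
   would turn a divergent integral into 0. *)
Definition bE Omega (u v w : vfield) : \bar R :=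
  (\int[lebm]_(x in Omega)
     (\sum_j (\sum_i (u i).1 x * (v j).2 i x) * (w j).1 x)%:E
   + 2^-1%:E * \int[lebm]_(x in Omega)
     (div u x * \sum_j (v j).1 x * (w j).1 x)%:E)%E.

Definition bhatE Omega (u : vfield) (s t : sfield) : \bar R :=
  (\int[lebm]_(x in Omega) ((\sum_i (u i).1 x * s.2 i x) * t.1 x)%:E
   + 2^-1%:E * \int[lebm]_(x in Omega) (div u x * (s.1 x * t.1 x))%:E)%E.

Definition b Omega (u v w : vfield) : R := fine (bE Omega u v w).
Definition bhat Omega (u : vfield) (s t : sfield) : R := fine (bhatE Omega u s t).

End spaces.

(* F is a bounded linear functional on the subspace S normed by N. *)
Definition in_dual (R : realType) (U : lmodType R) (S : set U) (N : U -> R)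
    (F : U -> R) : Prop :=
  (forall (a : R) y z, S y -> S z -> F (a *: y + z) = a * F y + F z) /\
  exists C : R, forall z, S z -> `|F z| <= C * N z.

(* z is a nonzero element of the normed space when N z != 0; as functions,
   representatives of 0 need not be identically 0. *)
Definition dual_norm (R : realType) (U : lmodType R) (S : set U) (N : U -> R)
    (F : U -> R) : R :=
  sup [set F z / N z | z in [set z | S z /\ N z != 0]].

Section iteration.
Context (R : realType) (d : nat) (Omega Gamma1 : set 'rV[R]_d).
Context (nu kappa Ri : R) (f : vfield R d -> R) (g : sfield R d -> R).

(* uk = u^k, (ut, Tt) = (\tilde u^{k+1}, \tilde T^{k+1}) *)
Definition picard_step (uk ut : vfield R d) (Tt : sfield R d) : Prop :=
  [/\ V_ Omega ut, D_ Omega Gamma1 Tt &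
   forall v w, V_ Omega v -> D_ Omega Gamma1 w ->
     b Omega uk ut v + nu * ip_grad_v Omega ut v
       = f v + Ri * ip_v Omega (last_component Tt) (values v) /\
     bhat Omega uk Tt w + kappa * ip_grad_s Omega Tt w = g w].

(* (u, T) = (u^{k+1}, T^{k+1}) *)
Definition newton_step (ut : vfield R d) (Tt : sfield R d)
    (u : vfield R d) (T : sfield R d) : Prop :=
  [/\ V_ Omega u, D_ Omega Gamma1 T &
   forall v w, V_ Omega v -> D_ Omega Gamma1 w ->
     b Omega u ut v + b Omega ut u v + nu * ip_grad_v Omega u v
       = f v + Ri * ip_v Omega (last_component T) (values v)
         + b Omega ut ut v /\
     bhat Omega u Tt w + bhat Omega ut T w + kappa * ip_grad_s Omega T w
       = g w + bhat Omega ut Tt w].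

End iteration.

(* Main.v *)
(* Testing the Picard step with its own solution bounds |grad Tt| by M2 and
   |grad ut| by M1; testing the Newton step with (u, T) then gives two linear
   inequalities in |grad u| and |grad T|, and their sum is the claim. All this
   rests on b(u,v,v) = bhat(u,s,s) = 0, which has to be derived from the
   definitions. For a test function phi and s in H^1 approximated by smooth
   functions, the weak derivative of s yields
     (phi d_i s, s) + 1/2 (d_i phi, s^2) = 0.
   A test function lies in H^1_0, because the integral of its derivative vanishes
   by translation invariance of Lebesgue measure; so the assumed trilinear bound
   allows one to replace phi by a general element of H^1_0. *)
Require Import Defs.
From HB Require Import structures.
From mathcomp Require Import all_boot all_order all_algebra.
From mathcomp Require Import all_classical all_reals all_analysis.
From mathcomp Require Import measurable_realfun ring lra.
Set Implicit Arguments.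
Unset Strict Implicit.
Unset Printing Implicit Defensive.
Import Order.TTheory GRing.Theory Num.Theory.
Import numFieldNormedType.Exports.
Local Open Scope classical_set_scope.
Local Open Scope ring_scope.

(** * Lebesgue measure on R^d *)

(** The [2 * M1] arises from the Newton step: the force contributes at most [M1], and the two terms
    quadratic in the Picard iterate, one in each equation, contribute
    [(alpha1 + alpha2) * M1 <= M1]. The terms linear in the unknown velocity cost [alpha1] and
    [alpha2] times its gradient norm, and buoyancy costs [nu^-1 * Ri * Cp ^+ 2] times that of the
    temperature; moved to the left, these are the coefficients of the claim. The obstacle is
    integrability: a product such as [w.1 x * s.2 i x * s.1 x] has three factors, and Cauchy-Schwarz
    handles only two. Since [bE] and [bhatE] are extended-real valued, their assumed finite bounds
    supply it. No boundary term appears, because a test function times a smooth function is again a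
    test function whatever the second factor does on the boundary; hence one argument serves both
    [X_] and [D_]. *)

Section lebesgue_measure_rV.
Context (R : realType) (d : nat).
Local Notation E := 'rV[R]_d.
Implicit Types (A U : set E) (a c v x : E).

Lemma box_gauge_le a c : (forall i, a ord0 i <= c ord0 i) ->
  (box_gauge (box a c) <= (\prod_i (c ord0 i - a ord0 i))%:E)%E.
Proof.
move=> ac; rewrite /box_gauge; case: ifP => _.
  by rewrite lee_fin prodr_ge0// => i _; rewrite subr_ge0.
by apply: ereal_inf_lbound; exists (a, c).
Qed.

(** A set that is not a box has gauge +oo, so only boxes matter. A hyperplane cuts a half-open box
    into two half-open boxes whose [i]-th sides add up, the other sides being unchanged. *)
Lemma box_gauge_ltD (i : 'I_d) (r : R) A (H := [set x : E | x ord0 i < r]) :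
  (box_gauge (A `&` H) + box_gauge (A `&` ~` H) <= box_gauge A)%E.
Proof.
rewrite [leRHS]/box_gauge; case: ifPn => [/asboolP ->|_].
  by rewrite !set0I !box_gauge0 adde0.
apply: le_ereal_inf_tmp => _ [[a c] [/= ac ->] <-].
(* Clamping [r] to the [i]-th side of the box covers the case of a hyperplane that misses it: one of
   the two pieces is then an empty box of volume 0. *)
pose s := Order.max (a ord0 i) (Order.min (c ord0 i) r).
have [as_ sc] : a ord0 i <= s /\ s <= c ord0 i.
  by rewrite /s le_max lexx/= ge_max ge_min lexx ac.
pose c' : E := \row_j if j == i then s else c ord0 j.
pose a' : E := \row_j if j == i then s else a ord0 j.
have -> : box a c `&` H = box a c'.
  apply/seteqP; split => [x [xac xr] j|x xac].
    rewrite mxE; case: eqP => [->|_]; last exact: xac.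
    have /andP[-> xc] := xac i.
    by rewrite /s lt_max lt_min xc (_ : x ord0 i < r)// orbT.
  have := xac i; rewrite mxE eqxx => /andP[ax xs].
  have [xc xr] : x ord0 i < c ord0 i /\ x ord0 i < r.
    by move: xs; rewrite /s lt_max ltNge ax/= lt_min => /andP[].
  split => // j; have := xac j; rewrite mxE; case: eqP => [->|//].
  by rewrite ax xc.
have -> : box a c `&` ~` H = box a' c.
  apply/seteqP; split => [x [xac /negP]|x xac].
    rewrite -leNgt => rx j; rewrite mxE; case: eqP => [->|_]; last exact: xac.
    have /andP[ax xc] := xac i.
    by rewrite xc andbT /s ge_max ax ge_min rx orbT.
  have := xac i; rewrite mxE eqxx => /andP[sx xc]; split.
    move=> j; have := xac j; rewrite mxE; case: eqP => [->|//] _.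
    by rewrite xc (le_trans as_).
  apply/negP; rewrite -leNgt; move: sx.
  by rewrite /s ge_max ge_min => /andP[_]; rewrite leNgt xc.
apply: (le_trans (leeD (box_gauge_le _) (box_gauge_le _))).
- by move=> j; rewrite mxE; case: eqP => [->|_] //.
- by move=> j; rewrite mxE; case: eqP => [->|_] //.
rewrite -EFinD lee_fin (bigD1 i)//= [X in _ + X <= _](bigD1 i)//=.
rewrite [leRHS](bigD1 i)//= !mxE eqxx.
under eq_bigr => j /negbTE ji do rewrite mxE ji.
under [X in _ + _ * X <= _]eq_bigr => j /negbTE ji do rewrite mxE ji.
by rewrite -mulrDl addrC addrA subrK lexx.
Qed.

(** The measurability that [mu_ext] asks of a cover is that of [discrete_type], where every set
    qualifies. *)
Lemma gauge_outer_le_cover (zeta : set E -> \bar R) A (F : (set E)^nat) :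
  A `<=` \bigcup_k F k ->
  (gauge_outer zeta A <= \sum_(k <oo) zeta (F k))%E.
Proof.
move=> AF; apply: ereal_inf_lbound; exists F => //; split => // k.
exact: sub_sigma_algebra.
Qed.

(** Cutting every member of a cover of [X] along the hyperplane gives covers of both parts of [X]
    with no larger total gauge, which is the Caratheodory inequality. *)
Lemma leb_measurable_lt (i : 'I_d) (r : R) :
  measurable ([set x : E | x ord0 i < r] : set (lebT R d)).
Proof.
set H := [set _ | _]; apply: (@le_caratheodory_measurable _ _ (leb_om R d)) => X.
apply: le_ereal_inf_tmp => _ [F [_ XF] <-].
have gF G n : (0 <= n)%N -> true -> (0 <= box_gauge (F n `&` G))%E.
  by move=> _ _; exact: box_gauge_ge0.
apply: (@le_trans _ _ (\sum_(k <oo) (box_gauge (F k `&` H)) +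
                       \sum_(k <oo) (box_gauge (F k `&` ~` H)))%E).
  by apply: leeD; apply: gauge_outer_le_cover => x [Xx Hx];
    have [k _ Fkx] := XF x Xx; exists k.
rewrite -nneseriesD; [|exact: gF|exact: gF].
apply: lee_nneseries => [n _ _|n _]; first by rewrite adde_ge0// gF.
exact: box_gauge_ltD.
Qed.

Lemma leb_measurable_cube a (e : R) :
  measurable ([set x : E | forall i, `|a ord0 i - x ord0 i| < e]
    : set (lebT R d)).
Proof.
(* Only half-spaces [x ord0 i < r] are known to be measurable, so the strict lower bound becomes a
   countable union of complements of such half-spaces. *)
rewrite (_ : [set _ | _] = \bigcap_(i in [set: 'I_d])
    ([set x : E | x ord0 i < a ord0 i + e] `&`
     \bigcup_n ~` [set x : E | x ord0 i < a ord0 i - e + n.+1%:R^-1])).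
  apply: fin_bigcap_measurable => // i _; apply: measurableI.
    exact: leb_measurable_lt.
  apply: bigcup_measurable => n _; apply: measurableC.
  exact: leb_measurable_lt.
apply/seteqP; split => x.
  move=> xe i _; have := xe i; rewrite distrC ltr_norml => /andP[xe1 xe2].
  split => /=; first lra.
  have /ltr_add_invr[n] : a ord0 i - e < x ord0 i by lra.
  by move=> en; exists n => //=; apply/negP; rewrite -leNgt ltW.
move=> xe i; have [/= xe1 [n _ /= /negP]] := xe i I.
rewrite -leNgt => xe2; rewrite distrC ltr_norml.
have : 0 < n.+1%:R^-1 :> R by [].
by move: n.+1%:R^-1 xe2 => q *; apply/andP; split; lra.
Qed.

(** Balls of the maximum norm are cubes, and cubes with rational centre and radius [n.+1%:R^-1] form
    a countable base. *)
Lemma leb_measurable_open U : open U -> measurable (U : set (lebT R d)).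
Proof.
move=> oU.
pose Q (p : 'rV[rat]_d * nat) :=
  [set x : E | forall i, `|ratr (p.1 ord0 i) - x ord0 i| < p.2.+1%:R^-1].
have -> : U = \bigcup_(p in [set p | Q p `<=` U]) Q p.
  apply/seteqP; split; last by move=> x [p /= pU /pU].
  move=> x Ux; move: oU; rewrite openE => /(_ x Ux).
  rewrite /interior => /nbhs_ballP[e /= e0 xeU].
  (* Half of [e] suffices: [x] lies within [n.+1%:R^-1] of the rational centre, and so does every
     other point of the cube. *)
  have /ltr_add_invr[n] : 0 < e / 2 by rewrite divr_gt0.
  rewrite add0r => ne.
  have q_ (i : 'I_d) : exists q : rat, `|ratr q - x ord0 i| < n.+1%:R^-1.
    have : 0 < n.+1%:R^-1 :> R by [].
    move: n.+1%:R^-1 => r r0.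
    have /rat_in_itvoo[q] : x ord0 i - r < x ord0 i + r by lra.
    rewrite in_itv/= => /andP[q1 q2]; exists q; rewrite ltr_norml.
    by apply/andP; split; lra.
  have [q qx] := choice q_.
  exists (\row_i q i, n) => /=; last by move=> i; rewrite mxE.
  move=> y Qy; apply: xeU; rewrite /ball/=; split => // i j.
  rewrite (ord1 i) /ball/=; have := Qy j; have := qx j; rewrite mxE.
  rewrite distrC => h1 h2.
  move: ne h1 h2; move: n.+1%:R^-1 => r ne h1 h2.
  by rewrite (le_lt_trans (ler_distD (ratr (q j)) _ _))//; lra.
rewrite bigcup_mkcond; apply: countable_bigcupT_measurable => [|p].
  exact: countableP.
case: ifP => // _.
have := leb_measurable_cube (map_mx ratr p.1) (p.2.+1%:R^-1).
by congr (measurable _); apply/seteqP; split => x xp i;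
  have := xp i; rewrite mxE.
Qed.

Lemma box_gauge_shift v A :
  (box_gauge ((fun x => (x + v)%R) @^-1` A) <= box_gauge A)%E.
Proof.
rewrite [leRHS]/box_gauge; case: ifPn => [/asboolP ->|_].
  by rewrite preimage_set0 box_gauge0.
apply: le_ereal_inf_tmp => _ [[a c] [/= ac ->] <-].
rewrite (_ : _ @^-1` _ = box (a - v) (c - v)); last first.
  by apply/seteqP; split => x xac i; have := xac i;
    rewrite !mxE lerBlDr ltrBrDr.
apply: (le_trans (box_gauge_le _)) => [i|].
  by rewrite !mxE lerB.
rewrite lee_fin le_eqVlt (_ : \prod_i _ = \prod_i (c ord0 i - a ord0 i)) ?eqxx//.
by apply: eq_bigr => i _; rewrite !mxE; ring.
Qed.

(** Shifting a cover by boxes does not increase its gauge; the reverse inequality is the same one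
    for the opposite shift. *)
Lemma leb_shift v A : leb ((fun x => (x + v)%R) @^-1` A) = leb A.
Proof.
have le_shift u B : (leb ((fun x => (x + u)%R) @^-1` B) <= leb B)%E.
  apply: le_ereal_inf_tmp => _ [F [_ BF] <-].
  apply: le_trans (lee_nneseries _ (fun n _ => box_gauge_shift u (F n))).
    apply: gauge_outer_le_cover => x /BF[k _ Fk]; by exists k.
  by move=> n _ _; exact: box_gauge_ge0.
apply/eqP; rewrite eq_le le_shift/=.
rewrite [leLHS](_ : _ = leb ((fun x => (x + - v)%R) @^-1`
    ((fun x => (x + v)%R) @^-1` A))) ?le_shift//.
by congr leb; apply/seteqP; split => x /=; rewrite subrK.
Qed.

Lemma leb_measurable_shift v A : measurable (A : set (lebT R d)) ->
  measurable ((fun x => x + v) @^-1` A : set (lebT R d)).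
Proof.
move=> mA; change (caratheodory_measurable leb ((fun x => x + v) @^-1` A)) => X.
have shiftK B : (fun x => x + v) @^-1` ((fun x => x + - v) @^-1` B) = B.
  by apply/seteqP; split => x /=; rewrite addrK.
have mAX Y : leb Y = (leb (Y `&` A) + leb (Y `&` ~` A))%E := mA Y.
rewrite -(leb_shift (- v)) mAX -(leb_shift v) -[X in (_ + X)%E](leb_shift v).
by rewrite !preimage_setI shiftK.
Qed.

Lemma rV_coord_le_norm x i : `|x ord0 i| <= `|x|.
Proof.
rewrite [leRHS]/Num.norm/= mx_normrE; apply/bigmax_geP; right => /=.
by exists (ord0, i).
Qed.

Lemma leb_bounded A : bounded_set A -> (leb A < +oo)%E.
Proof.
move=> [M [Mr AM]]; pose r := `|M| + 1.
have Mr1 : M < r by rewrite (le_lt_trans (ler_norm _))// ltrDl.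
have r0 : 0 <= r by rewrite addr_ge0.
(* The upper corner is [r + 1] because boxes omit their upper faces, while a coordinate equal to [r]
   must be allowed. *)
pose a : E := \row__ (- r); pose c : E := \row__ (r + 1).
apply: (@le_lt_trans _ _ (leb (box a c))).
  apply: le_gauge_outer => x /(AM r Mr1) /= xr i.
  rewrite !mxE; have := le_trans (rV_coord_le_norm x i) xr.
  by rewrite ler_norml => /andP[-> xr1]/=; rewrite (le_lt_trans xr1)// ltrDl.
apply: (@le_lt_trans _ _ (\sum_(k <oo) box_gauge (bigcup2 (box a c) set0 k))%E).
  by apply: gauge_outer_le_cover => x bx; exists 0%N.
rewrite (@nneseries_split _ _ 0 1); last by move=> n _; exact: box_gauge_ge0.
rewrite eseries0 ?adde0; last by move=> [|[|k]]//= _ _; rewrite box_gauge0.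
rewrite add0n big_nat1/=; apply: (le_lt_trans (box_gauge_le _)).
  by move=> i; rewrite !mxE; lra.
exact: ltry.
Qed.

Lemma leb_measurable_fun U (f : E -> R) : open U -> continuous f ->
  measurable_fun (U : set (lebT R d)) (f : lebT R d -> R).
Proof.
move=> oU cf; apply: (measurability _ (RGenOpens.measurableE R)).
move=> _ [_ [r [q ->]] <-]; apply: leb_measurable_open.
by apply: openI => //; apply: open_comp => [x _|]; [exact: cf|exact: interval_open].
Qed.
End lebesgue_measure_rV.

(** * Integration by parts for test functions *)

Section smooth_functions.
Context (R : realType) (d : nat).
Local Notation E := 'rV[R]_d.
Implicit Types (f g : E -> R) (Omega : set E).

Lemma CkS n f : Ck n.+1 f -> Ck n f.
Proof.
elim: n f => [f []//|n IHn f [cf df Cf]].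
by split => // i; exact/IHn/Cf.
Qed.

Lemma CkB n f g : Ck n f -> Ck n g -> Ck n (fun x => f x - g x).
Proof.
elim: n f g => [f g /= cf cg x|n IHn f g [cf df Cf] [cg dg Cg]].
  by apply: continuousB; [exact: cf|exact: cg].
split => [x|i x|i].
- by apply: continuousB; [exact: cf|exact: cg].
- exact: derivableB.
- rewrite (_ : partial i _ = fun x => partial i f x - partial i g x).
    by apply: IHn; [exact: Cf|exact: Cg].
  by apply/funext => x; rewrite /partial deriveB.
Qed.

Lemma CkD n f g : Ck n f -> Ck n g -> Ck n (fun x => f x + g x).
Proof.
elim: n f g => [f g /= cf cg x|n IHn f g [cf df Cf] [cg dg Cg]].
  by apply: continuousD; [exact: cf|exact: cg].
split => [x|i x|i].
- by apply: continuousD; [exact: cf|exact: cg].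
- exact: derivableD.
- rewrite (_ : partial i _ = fun x => partial i f x + partial i g x).
    by apply: IHn; [exact: Cf|exact: Cg].
  by apply/funext => x; rewrite /partial deriveD.
Qed.

(** The Leibniz rule multiplies a derivative of one factor by the other factor itself, so [CkS] is
    needed to lower the order of the latter. *)
Lemma CkM n f g : Ck n f -> Ck n g -> Ck n (fun x => f x * g x).
Proof.
elim: n f g => [f g /= cf cg x|n IHn f g Cf Cg].
  by apply: continuousM; [exact: cf|exact: cg].
have [cf df pf] := Cf; have [cg dg pg] := Cg.
split => [x|i x|i].
- by apply: continuousM; [exact: cf|exact: cg].
- exact: derivableM.
- rewrite (_ : partial i _ =
      fun x => f x * partial i g x + g x * partial i f x).
    by apply: CkD; apply: IHn; [exact: CkS|exact: pg|exact: CkS|exact: pf].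
  by apply/funext => x; rewrite /partial deriveM.
Qed.

Lemma smooth_continuous f : smooth f -> continuous f.
Proof. by move=> sf; have := sf 0%N. Qed.

Lemma smooth_derivable f i x : smooth f -> derivable f x (delta_mx ord0 i).
Proof. by move=> sf; have [_ df _] := sf 1%N; exact: df. Qed.

Lemma smooth_partial f i : smooth f -> smooth (partial i f).
Proof. by move=> sf n; have [_ _ pf] := sf n.+1; exact: pf. Qed.

Lemma smoothB f g : smooth f -> smooth g -> smooth (fun x => f x - g x).
Proof. by move=> sf sg n; exact: CkB. Qed.

Lemma smoothM f g : smooth f -> smooth g -> smooth (fun x => f x * g x).
Proof. by move=> sf sg n; exact: CkM. Qed.

Lemma partialB f g i x : smooth f -> smooth g ->
  partial i (fun y => f y - g y) x = partial i f x - partial i g x.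
Proof. by move=> sf sg; rewrite /partial deriveB//; exact: smooth_derivable. Qed.

Lemma partialM f g i x : smooth f -> smooth g ->
  partial i (fun y => f y * g y) x = f x * partial i g x + g x * partial i f x.
Proof. by move=> sf sg; rewrite /partial deriveM//; exact: smooth_derivable. Qed.

Lemma partial_cst (r : R) i x : partial i (fun _ : E => r) x = 0.
Proof. exact: (@derive_cst R E R). Qed.

Lemma smooth_cst (r : R) : smooth (fun _ : E => r).
Proof.
move=> n; elim: n r => [|n IHn] r /=; first exact: cst_continuous.
split => // [|i]; first exact: cst_continuous.
rewrite (_ : partial i _ = fun=> 0)//.
by apply/funext => x; rewrite partial_cst.
Qed.

Lemma test_functionM Omega f g : test_function Omega f -> smooth g ->
  test_function Omega (fun x => f x * g x).
Proof.
move=> [sf [K [cK KO f0]]] sg; split; first exact: smoothM.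
by exists K; split => // x /f0 ->; rewrite mul0r.
Qed.

Lemma test_functionB Omega f g : test_function Omega f ->
  test_function Omega g -> test_function Omega (fun x => f x - g x).
Proof.
move=> [sf [K [cK KO f0]]] [sg [L [cL LO g0]]]; split; first exact: smoothB.
exists (K `|` L); split; [exact: compactU|by rewrite subUset|].
by move=> x /not_orP[/f0 -> /g0 ->]; rewrite subrr.
Qed.

(** The complement of a compact set is open, so [f] is zero in a whole neighbourhood of [x]. *)
Lemma partial_eq0 f (K : set E) i x : compact K ->
  (forall y, ~ K y -> f y = 0) -> ~ K x -> partial i f x = 0.
Proof.
move=> cK f0 Kx; have oK : open (~` K).
  by rewrite openC; exact: (compact_closed (@norm_hausdorff _ _)).
rewrite /partial (near_eq_derive (f := f) (g := cst 0)).
  by rewrite derive_cst.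
have : nbhs x (~` K) by exact: open_nbhs_nbhs.
by apply: filterS => y /f0.
Qed.
End smooth_functions.

Section integral_partial.
Context (R : realType) (d : nat).
Local Notation E := 'rV[R]_d.
Implicit Types (f : E -> R) (K A : set E) (v x : E).

Lemma continuous_compact_le f K : continuous f -> compact K ->
  exists2 M : R, 0 <= M & forall x, K x -> `|f x| <= M.
Proof.
move=> cf cK; have cfK : {within K, continuous f} by exact: continuous_subspaceT.
have [M [_ Mf]] := compact_bounded (continuous_compact cfK cK).
exists (`|M| + 1) => [|x Kx]; first by rewrite addr_ge0.
by apply: Mf; [rewrite (le_lt_trans (ler_norm _))// ltrDl|exists x].
Qed.

Lemma lebm_integrable_bounded A f (M : R) : measurable (A : set (lebT R d)) ->
  (leb A < +oo)%E -> measurable_fun (A : set (lebT R d)) (f : lebT R d -> R) ->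
  (forall x, A x -> `|f x| <= M) -> lebm.-integrable A (EFin \o f).
Proof.
move=> mA Afin mf fM; apply: measurable_bounded_integrable => //.
exists M; split; first exact: num_real.
by move=> N MN x Ax /=; rewrite (le_trans (fM _ Ax))// ltW.
Qed.

Lemma Rintegral_shift f v : lebm.-integrable setT (EFin \o f) ->
  \int[lebm]_x f (x + v) = \int[lebm]_x f x.
Proof.
move=> intf; have mf : measurable_fun [set: lebT R d] (EFin \o f).
  exact: measurable_int intf.
have mshift (u : E) : measurable_fun [set: lebT R d]
    ((fun x => x + u) : lebT R d -> lebT R d).
  by move=> _ A mA; rewrite setTI; exact: leb_measurable_shift.
have mfv := measurableT_comp mf (mshift v).
have fvE : (EFin \o f \o (fun x => x + v)) \o (fun x => x + - v) = EFin \o f.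
  by apply/funext => x /=; rewrite subrK.
(* The function pushed forward is the shifted one, along the shift by [- v]: the composite is [f]
   itself, whose integrability is given. *)
have := @integral_pushforward _ _ _ _ R _ (mshift (- v)) lebm setT _ mfv.
rewrite preimage_setT fvE => /(_ intf measurableT) H.
rewrite /Rintegral -[in RHS]H; congr fine.
by apply: eq_measure_integral => A mA _; rewrite [RHS]leb_shift.
Qed.

(** Restricts [f] to a line parallel to an axis, so that the one-variable mean value theorem
    applies. *)
Lemma partial_is_derive f i x (t : R) : smooth f ->
  is_derive t (1 : R) (fun s : R => f (s *: delta_mx ord0 i + x))
    (partial i f (t *: delta_mx ord0 i + x)).
Proof.
move=> sf; set e := delta_mx ord0 i.
have fE : (fun h : R => h^-1 *: (((fun s => f (s *: e + x)) \o shift t) (h *: 1) -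
      f (t *: e + x))) =
    (fun h => h^-1 *: ((f \o shift (t *: e + x)) (h *: e) - f (t *: e + x))).
  by apply/funext => h /=; rewrite [h *: 1]mulr1 scalerDl addrA.
apply: DeriveDef; last by rewrite /derive fE.
rewrite /derivable fE.
exact: smooth_derivable.
Qed.

(** Bounds the difference quotients uniformly in the step [h], which is the domination needed to
    pass to the limit under the integral. *)
Lemma partial_lipschitz f i (L : R) x (h : R) : smooth f ->
  (forall y, `|partial i f y| <= L) -> 0 < h ->
  `|f (h *: delta_mx ord0 i + x) - f x| <= L * h.
Proof.
move=> sf fL h0.
have [||c _] := @MVT R (fun s : R => f (s *: delta_mx ord0 i + x))
    (fun s => partial i f (s *: delta_mx ord0 i + x)) 0 h h0.
- by move=> s _; exact: partial_is_derive.
- apply: derivable_within_continuous => s _.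
  by have [] := partial_is_derive i x s sf.
- rewrite scale0r add0r subr0 => ->.
  by rewrite normrM (gtr0_norm h0) ler_pM2r.
Qed.

Lemma partial_cvg f i x : smooth f ->
  n.+1%:R * (f (n.+1%:R^-1 *: delta_mx ord0 i + x) - f x) @[n --> \oo]
  --> partial i f x.
Proof.
move=> sf; have df : derivable f x (delta_mx ord0 i) by exact: smooth_derivable.
have : h^-1 *: ((f \o shift x) (h *: delta_mx ord0 i) - f x) @[h --> 0^']
  --> partial i f x := df.
move/cvgr_dnbhsP => /(_ (fun n => n.+1%:R^-1)) H.
apply: cvg_trans (H _); last first.
  by split => [n|]; [rewrite invr_eq0|exact: cvg_harmonic].
by apply: near_eq_cvg; apply: nearW => n /=; rewrite invrK.
Qed.

(* By translation invariance the difference quotients of [f] integrate to 0. *)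
Lemma integral_partial0 f i K : smooth f -> compact K ->
  (forall x, ~ K x -> f x = 0) -> \int[lebm]_x partial i f x = 0.
Proof.
move=> sf cK f0; set e : E := delta_mx ord0 i.
have cf := smooth_continuous sf; have cg := smooth_continuous (smooth_partial i sf).
have [M M0 fM] := continuous_compact_le cf cK.
have [L L0 gL] := continuous_compact_le cg cK.
have g0 := partial_eq0 i cK f0.
have {}fM x : `|f x| <= M.
  by have [/fM//|/f0->] := pselect (K x); rewrite normr0.
have {}gL x : `|partial i f x| <= L.
  by have [/gL//|/g0->] := pselect (K x); rewrite normr0.
have [r Kr] : exists r : R, forall x, K x -> `|x| <= r.
  have [r [_ Kr]] := compact_bounded cK.
  exists (`|r| + 1) => x; apply: Kr.
  by rewrite (le_lt_trans (ler_norm _))// ltrDl.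
(* This ball contains [K] and its translates by at most [e] along the axis, so [f] and all the
   difference quotients vanish outside it; having finite measure, it makes constants integrable. The
   summand 1 only makes inequalities strict. *)
pose A : set E := ball 0 (r + `|e| + 1).
have AE x : A x = (`|x| < r + `|e| + 1) :> Prop.
  by rewrite /A -ball_normE /ball_/= sub0r normrN.
have mA : measurable (A : set (lebT R d)).
  by apply: leb_measurable_open; exact: ball_open.
have Afin : (leb A < +oo)%E.
  apply: leb_bounded; exists (r + `|e| + 1); split; first exact: num_real.
  by move=> N rN x; rewrite AE => /ltW/le_trans; apply; exact: ltW.
have fA0 x : ~ A x -> f x = 0.
  rewrite AE => Ax; apply: f0 => /Kr xr; apply: Ax.
  by rewrite -addrA (le_lt_trans xr)// ltrDl ltr_wpDl.
have fsA0 n x : ~ A x -> f (x + n.+1%:R^-1 *: e) = 0.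
  rewrite AE => Ax; apply: f0 => /Kr xr; apply: Ax.
  rewrite -(addrK (n.+1%:R^-1 *: e) x) (le_lt_trans (ler_normB _ _))//.
  rewrite -addrA ler_ltD// normrZ ltr_pwDr// ler_piMl// ger0_norm//.
  by rewrite invf_le1// ler1n.
have intA h : continuous h -> (forall x, `|h x| <= M) ->
    lebm.-integrable A (EFin \o h).
  move=> ch hM; apply: (lebm_integrable_bounded mA Afin _ (fun x _ => hM x)).
  by apply: leb_measurable_fun ch; exact: ball_open.
have intf := intA _ cf fM.
have intT : lebm.-integrable setT (EFin \o f).
  have := (integrable_mkcond _ mA).1 intf.
  congr (_.-integrable _ _); apply/funext => x.
  by rewrite patchE; case: ifPn => // /negP; rewrite inE => /fA0 /= ->.
have RintT h : (forall x, ~ A x -> h x = 0) ->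
    \int[lebm]_x h x = \int[lebm]_(x in A) h x.
  move=> hA; rewrite [RHS]Rintegral_mkcond; apply: eq_Rintegral => x _.
  by rewrite patchE; case: ifPn => // /negP; rewrite inE => /hA.
pose q n x := n.+1%:R * (f (n.+1%:R^-1 *: e + x) - f x).
have intq n : (\int[lebm]_(x in A) (q n x)%:E = 0)%E.
  have cfs : continuous (fun x => f (x + n.+1%:R^-1 *: e)).
    by move=> x; apply: (@continuous_comp _ _ _ (fun x => x + n.+1%:R^-1 *: e) f);
      [apply: continuousD; [exact: cvg_id|exact: cst_continuous]|exact: cf].
  have intfs := intA _ cfs (fun x => fM _).
  rewrite (_ : q n = fun x => n.+1%:R * (f (x + n.+1%:R^-1 *: e) - f x)); last first.
    by apply/funext => x; rewrite /q [_ *: e + x]addrC.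
  have intB := integrableB mA intfs intf.
  rewrite -[LHS]fineK; last exact: integrable_fin_num (integrableZl mA _ intB).
  congr EFin; rewrite -/(Rintegral _ _ _) RintegralZl//=.
  rewrite RintegralB// -RintT//; last exact: fsA0.
  by rewrite -RintT// Rintegral_shift// subrr mulr0.
rewrite RintT; last first.
  by move=> x Ax; apply: g0 => /Kr xr; apply: Ax; rewrite AE
    -addrA (le_lt_trans xr)// ltrDl ltr_wpDl.
have cq n : continuous (q n).
  rewrite /q => x; apply: (@continuousM _ _ (cst (n.+1%:R : R))
    (fun y => f (n.+1%:R^-1 *: e + y) - f y)); first exact: cst_continuous.
  apply: continuousB; last exact: cf.
  apply: (@continuous_comp _ _ _ (fun x => n.+1%:R^-1 *: e + x) f); last exact: cf.
  by apply: continuousD; [exact: cst_continuous|exact: cvg_id].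
have mcont (h : E -> R) : continuous h ->
    measurable_fun (A : set (lebT R d)) (EFin \o h).
  move=> ch; apply/measurable_EFinP; apply: leb_measurable_fun ch.
  exact: ball_open.
have [] := @dominated_convergence _ _ _ lebm A mA (fun n => EFin \o q n)
  (EFin \o partial i f) (EFin \o cst L).
- by move=> n; exact: mcont.
- exact: mcont.
- by apply: aeW => x _; apply: cvg_EFin; [exact: nearW|exact: partial_cvg].
- apply: (lebm_integrable_bounded mA Afin (M := L)) => [|x _].
    exact: measurable_cst.
  by rewrite ger0_norm.
- apply: aeW => x n _; rewrite /= lee_fin /q normrM ger0_norm//.
  rewrite mulrC -ler_pdivlMr//; exact: partial_lipschitz.
move=> _ _ /= intg.
have {}intq : (fun n => \int[lebm]_(x in A) (q n x)%:E)%E = cst 0%E.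
  by apply/funext => n; exact: intq.
rewrite intq in intg.
by rewrite /Rintegral (cvg_unique _ intg (cvg_cst 0%E)).
Qed.

End integral_partial.

(** * Sobolev functions and skew symmetry *)

Section L2_theory.
Context (R : realType) (d : nat) (Omega : set 'rV[R]_d).
Hypotheses (oO : open Omega) (bO : bounded_set Omega).
Local Notation E := 'rV[R]_d.
Implicit Types (f g h : E -> R).

Lemma measurable_Omega : measurable (Omega : set (lebT R d)).
Proof. exact: leb_measurable_open. Qed.
Let mO := measurable_Omega.

(** [Omega] is not compact, but it lies in a closed ball, which is, and [f] is continuous on the
    whole space. *)
Lemma continuous_bounded_le f : continuous f ->
  exists2 M : R, 0 <= M & forall x, Omega x -> `|f x| <= M.
Proof.
have [r [_ Or]] := bO; move=> cf.
have r0 : 0 < `|r| + 2 by rewrite ltr_wpDl.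
have cB : compact (closed_ball (0 : E) (`|r| + 2)).
  apply: bounded_closed_compact; last exact: closed_ball_closed.
  exists (`|r| + 2); split; first exact: num_real.
  move=> M rM x; rewrite closed_ballE// /closed_ball_ /= sub0r normrN.
  by move=> /le_trans; apply; exact: ltW.
have [M M0 fM] := continuous_compact_le cf cB.
exists M => // x Ox; apply: fM.
rewrite closed_ballE// /closed_ball_ /= sub0r normrN.
apply: (le_trans (Or (`|r| + 1) _ _ Ox)); last by rewrite lerD2l ler1n.
by rewrite (le_lt_trans (ler_norm _))// ltrDl.
Qed.

Lemma L2_integrable_sqr f : L2 Omega f ->
  lebm.-integrable Omega (EFin \o (fun x => f x ^+ 2)).
Proof.
move=> [mf f2]; apply/integrableP; split.
  by apply/measurable_EFinP; exact: measurable_funX.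
apply: le_lt_trans f2; rewrite le_eqVlt; apply/orP; left; apply/eqP.
by apply: eq_integral => x _ /=; rewrite ger0_norm ?sqr_ge0.
Qed.

(** The product is dominated by [f x ^+ 2 + g x ^+ 2]. *)
Lemma L2M_integrable f g : L2 Omega f -> L2 Omega g ->
  lebm.-integrable Omega (EFin \o (fun x => f x * g x)).
Proof.
move=> Lf Lg; have [[mf _] [mg _]] := (Lf, Lg).
have := integrableD mO (L2_integrable_sqr Lf) (L2_integrable_sqr Lg).
apply: le_integrable => //.
  by apply/measurable_EFinP; exact: measurable_funM.
move=> x _; rewrite /= lee_fin normrM [leRHS]ger0_norm ?addr_ge0 ?sqr_ge0//.
rewrite -(real_normK (num_real (f x))) -(real_normK (num_real (g x))).
by have := normr_ge0 (f x); have := normr_ge0 (g x); nra.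
Qed.

Lemma L2_lincomb (a : R) f g : L2 Omega f -> L2 Omega g ->
  L2 Omega (fun x => a * f x + g x).
Proof.
move=> Lf Lg; have [[mf _] [mg _]] := (Lf, Lg).
split; first by apply: measurable_funD => //; exact: measurable_funM.
have := integrableD mO (integrableZl mO (a ^+ 2) (L2M_integrable Lf Lf))
  (integrableD mO (integrableZl mO (2 * a) (L2M_integrable Lf Lg)) (L2M_integrable Lg Lg)).
move=> /(integrable_lty mO); apply: le_lt_trans.
rewrite le_eqVlt; apply/orP; left; apply/eqP.
by apply: eq_integral => x _; rewrite /= -!EFinM -!EFinD; congr (_%:E); ring.
Qed.

Lemma L2B f g : L2 Omega f -> L2 Omega g -> L2 Omega (fun x => f x - g x).
Proof.
move=> Lf Lg; rewrite (_ : (fun x => _) = (fun x => -1 * g x + f x)).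
  exact: L2_lincomb.
by apply/funext => x; ring.
Qed.

Lemma L2_bounded f g (M : R) : L2 Omega f ->
  measurable_fun (Omega : set (lebT R d)) (g : lebT R d -> R) ->
  (forall x, Omega x -> `|g x| <= M) -> L2 Omega (fun x => f x * g x).
Proof.
move=> Lf mg gM; have [mf _] := Lf.
have mfg : measurable_fun (Omega : set (lebT R d))
    ((fun x => f x * g x) : lebT R d -> R) by exact: measurable_funM.
split => //.
apply: (integrable_lty mO).
apply: le_integrable (integrableZl mO (M ^+ 2) (L2_integrable_sqr Lf)) => //.
  by apply/measurable_EFinP; exact: measurable_funX.
move=> x Ox; have M0 : 0 <= M := le_trans (normr_ge0 _) (gM _ Ox).
have gxM : g x ^+ 2 <= M ^+ 2.
  by rewrite -(real_normK (num_real (g x))) lerXn2r ?nnegrE ?gM.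
rewrite /= lee_fin ger0_norm ?sqr_ge0// ger0_norm; last first.
  by apply: mulr_ge0; exact: sqr_ge0.
by rewrite exprMn mulrC ler_wpM2r ?sqr_ge0.
Qed.

Lemma L2_continuous f : continuous f -> L2 Omega f.
Proof.
move=> cf; have mf := leb_measurable_fun oO cf.
have [M M0 fM] := continuous_bounded_le cf; split => //.
apply: (integrable_lty mO); apply: (lebm_integrable_bounded (M := M ^+ 2)) => //.
- exact: leb_bounded.
- exact: measurable_funX.
- by move=> x Ox; rewrite normrX lerXn2r// ?nnegrE// fM.
Qed.

Lemma L2M_continuous f g : L2 Omega f -> continuous g ->
  L2 Omega (fun x => f x * g x).
Proof.
move=> Lf cg; have [M M0 gM] := continuous_bounded_le cg.
exact: (L2_bounded Lf (leb_measurable_fun oO cg) gM).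
Qed.

Lemma ip_s_ge0 f : 0 <= ip_s Omega f f.
Proof. by apply: Rintegral_ge0 => x _; rewrite -expr2 sqr_ge0. Qed.

Lemma ip_sC f g : ip_s Omega f g = ip_s Omega g f.
Proof. by apply: eq_Rintegral => x _; rewrite mulrC. Qed.

Lemma ip_s_lincomb (a : R) f g h : L2 Omega f -> L2 Omega g -> L2 Omega h ->
  ip_s Omega (fun x => a * f x + g x) h = a * ip_s Omega f h + ip_s Omega g h.
Proof.
move=> Lf Lg Lh; have ifh := L2M_integrable Lf Lh.
rewrite /ip_s -RintegralZl// -RintegralD//.
- by apply: eq_Rintegral => x _; ring.
- exact: (integrableZl mO a ifh).
- exact: L2M_integrable.
Qed.

Lemma ip_sB f g h : L2 Omega f -> L2 Omega g -> L2 Omega h ->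
  ip_s Omega (fun x => f x - g x) h = ip_s Omega f h - ip_s Omega g h.
Proof.
move=> Lf Lg Lh; rewrite -RintegralB//; try exact: L2M_integrable.
by apply: eq_Rintegral => x _; ring.
Qed.

Lemma ip_s_CauchySchwarz f g : L2 Omega f -> L2 Omega g ->
  `|ip_s Omega f g| <= Num.sqrt (ip_s Omega f f) * Num.sqrt (ip_s Omega g g).
Proof.
move=> Lf Lg; set a := ip_s Omega f f; set c := ip_s Omega f g.
set e := ip_s Omega g g.
have a0 : 0 <= a by exact: ip_s_ge0.
have e0 : 0 <= e by exact: ip_s_ge0.
have quad t : 0 <= t ^+ 2 * a + 2 * t * c + e.
  have := ip_s_ge0 (fun x => t * f x + g x).
  have Ltfg := L2_lincomb t Lf Lg.
  rewrite ip_s_lincomb// ![ip_s _ _ (fun x => _ + _)]ip_sC !ip_s_lincomb//.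
  by rewrite (ip_sC g f) -/a -/c -/e; congr (_ <= _); ring.
have ce : c ^+ 2 <= a * e.
  (* If [a = 0], the quadratic is affine in [t]; a nonzero [c] would let it reach -1 at the value of
     [t] chosen below. Otherwise the minimiser [- c / a] gives the discriminant inequality. *)
  have [a00|a_neq0] := eqVneq a 0.
    have [->|c0] := eqVneq c 0; first by rewrite expr0n a00 mul0r.
    have := quad (- (e + 1) / (2 * c)).
    rewrite a00 mulr0 add0r (_ : 2 * _ * c = - (e + 1)) ?lerDl//.
      by rewrite opprD addrAC addNr add0r oppr_ge0 ler10.
    by field.
  have := quad (- c / a); rewrite (_ : _ + e = e - c ^+ 2 / a); last by field.
  by rewrite subr_ge0 ler_pdivrMr ?lt0r ?a_neq0// mulrC.
rewrite -sqrtrM// -sqrtr_sqr; exact: ler_wsqrtr.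
Qed.

(** Strong convergence in L^2 implies weak convergence, by Cauchy-Schwarz against the fixed [g]. *)
Lemma ip_s_cvg (F : nat -> E -> R) f g :
  (forall n, L2 Omega (F n)) -> L2 Omega f -> L2 Omega g ->
  ip_s Omega (fun x => F n x - f x) (fun x => F n x - f x) @[n --> \oo] --> 0 ->
  ip_s Omega (F n) g @[n --> \oo] --> ip_s Omega f g.
Proof.
move=> LF Lf Lg Ff.
have H n : `|ip_s Omega f g - ip_s Omega (F n) g| <=
   Num.sqrt (ip_s Omega (fun x => F n x - f x) (fun x => F n x - f x)) *
   Num.sqrt (ip_s Omega g g).
  by rewrite distrC -ip_sB//; apply: ip_s_CauchySchwarz => //; exact: L2B.
apply/cvgrPdist_le => e e0.
have cs : Num.sqrt (ip_s Omega (fun x => F n x - f x) (fun x => F n x - f x)) *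
   Num.sqrt (ip_s Omega g g) @[n --> \oo] --> 0.
  rewrite -(mul0r (Num.sqrt (ip_s Omega g g))) -sqrtr0.
  apply: cvgM; last exact: cvg_cst.
  by apply: continuous_cvg => //; exact: sqrt_continuous.
move/cvgrPdist_le : cs => /(_ e e0); apply: filterS => n.
rewrite sub0r normrN ger0_norm ?mulr_ge0 ?sqrtr_ge0//.
exact: le_trans.
Qed.

End L2_theory.

(** * Approximation by smooth functions, and the skew identity for a single component *)

Section sobolev.
Context (R : realType) (d : nat) (Omega : set 'rV[R]_d).
Hypotheses (oO : open Omega) (bO : bounded_set Omega).
Local Notation E := 'rV[R]_d.
Implicit Types (w s : sfield R d) (phi psi : E -> R).

Definition smooth_field phi : sfield R d := (phi, fun i => partial i phi).

Lemma sfield_lincombE (a : R) w s :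
  (forall x, (a *: w + s).1 x = a * w.1 x + s.1 x) *
  (forall i x, (a *: w + s).2 i x = a * w.2 i x + s.2 i x).
Proof.
split=> [x|i x].
- by transitivity ((a *: w).1 x + s.1 x); [reflexivity|congr (_ + _)].
- by transitivity ((a *: w).2 i x + s.2 i x); [reflexivity|congr (_ + _)].
Qed.

Lemma sfieldNE w :
  (forall x, (- w).1 x = - w.1 x) * (forall i x, (- w).2 i x = - w.2 i x).
Proof. by split; move=> *; reflexivity. Qed.

Lemma H1_lincomb (a : R) w s : H1 Omega w -> H1 Omega s -> H1 Omega (a *: w + s).
Proof.
move=> [Lw Lgw Iw] [Ls Lgs Is]; split; [exact: L2_lincomb|
  by move=> i; exact: (L2_lincomb oO a (Lgw i) (Lgs i))|].
move=> i phi tphi; have [sphi _] := tphi.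
have Lphi := L2_continuous oO bO (smooth_continuous sphi).
have Lpphi := L2_continuous oO bO (smooth_continuous (smooth_partial i sphi)).
have := ip_s_lincomb oO a Lw Ls Lpphi.
have := ip_s_lincomb oO a (Lgw i) (Lgs i) Lphi.
rewrite /ip_s Iw// Is// => h1 h2.
by rewrite [LHS]h2 [in RHS]h1; ring.
Qed.

(** Against a test function [chi], the weak derivative identity says that the integral of the
    derivative of [phi * chi] is 0. The support of [phi] inside [Omega] lets that integral be taken
    over the whole space. *)
Lemma H1_smooth_field phi : test_function Omega phi -> H1 Omega (smooth_field phi).
Proof.
move=> [sphi [K [cK KO phi0]]].
split => [|i|i chi [schi _]]; [|exact/L2_continuous/smooth_continuous/smooth_partial|].
  exact/L2_continuous/smooth_continuous.
have sprod := smoothM sphi schi.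
have prod0 x : ~ K x -> phi x * chi x = 0 by move=> /phi0 ->; rewrite mul0r.
have := integral_partial0 i sprod cK prod0.
have -> : \int[lebm]_x partial i (fun y => phi y * chi y) x =
    \int[lebm]_(x in Omega) partial i (fun y => phi y * chi y) x.
  rewrite [RHS]Rintegral_mkcond; apply: eq_Rintegral => x _.
  rewrite patchE; case: ifPn => // /negP; rewrite inE => Ox.
  by apply: (partial_eq0 _ cK prod0) => /KO.
under eq_Rintegral do rewrite partialM//.
have Lphi := L2_continuous oO bO (smooth_continuous sphi).
have Lchi := L2_continuous oO bO (smooth_continuous schi).
have Lpphi := L2_continuous oO bO (smooth_continuous (smooth_partial i sphi)).
have Lpchi := L2_continuous oO bO (smooth_continuous (smooth_partial i schi)).
rewrite RintegralD//; [|exact: measurable_Omega|exact: L2M_integrable|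
  exact: L2M_integrable].
move=> /eqP; rewrite addr_eq0 => /eqP ->; congr (- _).
by apply: eq_Rintegral => x _; rewrite mulrC.
Qed.

(** Comparing only squares covers both a common shift and a change of sign. *)
Lemma eq_H1_cvg (F G : nat -> E -> R) w s :
  (forall n x, (G n x - s.1 x) ^+ 2 = (F n x - w.1 x) ^+ 2) ->
  (forall n i x, (partial i (G n) x - s.2 i x) ^+ 2 =
                 (partial i (F n) x - w.2 i x) ^+ 2) ->
  H1_cvg Omega F w -> H1_cvg Omega G s.
Proof.
move=> e0 e1; apply: cvg_trans; apply: near_eq_cvg; apply: nearW => n.
apply: eq_integral => x _; congr (_%:E); congr (_ + _); first exact/esym/e0.
by apply: eq_bigr => i _; rewrite e1.
Qed.

Lemma H10_smooth_field phi : test_function Omega phi ->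
  H10 Omega (smooth_field phi).
Proof.
move=> tphi; split; first exact: H1_smooth_field.
exists (fun=> phi); split => //; rewrite /H1_cvg/= (_ : (fun=> _) = cst 0%E).
  exact: cvg_cst.
apply/funext => n; apply: (@integral0_eq _ _ _ lebm) => x _ /=.
by rewrite subrr expr0n add0r big1// => i _; rewrite subrr expr0n.
Qed.

Lemma H10B_smooth_field phi w : test_function Omega phi -> H10 Omega w ->
  H10 Omega (-1 *: smooth_field phi + w).
Proof.
move=> tphi [Hw [psi [tpsi cpsi]]]; have [sphi _] := tphi; split.
  by apply: H1_lincomb => //; exact: H1_smooth_field.
exists (fun n x => psi n x - phi x); split; first by move=> n; exact: test_functionB.
apply: eq_H1_cvg cpsi => n => [x|i x]; have [spsi _] := tpsi n.
  by rewrite sfield_lincombE /=; congr (_ ^+ 2); ring.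
by rewrite sfield_lincombE partialB//=; congr (_ ^+ 2); ring.
Qed.

Lemma H1_cvgN (F : nat -> E -> R) w : (forall n, smooth (F n)) ->
  H1_cvg Omega F w -> H1_cvg Omega (fun n x => F n x * -1) (- w).
Proof.
move=> sF; apply: eq_H1_cvg => n => [x|i x]; first by rewrite sfieldNE; ring.
rewrite sfieldNE partialM//=; last exact: smooth_cst.
by rewrite partial_cst; ring.
Qed.

Lemma H1N w : H1 Omega w -> H1 Omega (- w).
Proof.
(* [H1_lincomb] only treats the shape [a *: w + s]; taking [s = w] avoids having to know that 0 is
   in [H1]. *)
move=> Hw; rewrite (_ : - w = -2 *: w + w); first exact: H1_lincomb.
by rewrite -[X in _ + X]scale1r -scalerDl -scaleN1r; congr (_ *: _); ring.
Qed.

Lemma H10N w : H10 Omega w -> H10 Omega (- w).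
Proof.
move=> [Hw [F [tF cF]]]; split; first exact: H1N.
exists (fun n x => F n x * -1); split => [n|].
  by apply: test_functionM => //; exact: smooth_cst.
by apply: H1_cvgN => // n; have [] := tF n.
Qed.

Lemma D_N Gamma w : D_ Omega Gamma w -> D_ Omega Gamma (- w).
Proof.
move=> [Hw [F [sF cF tF]]]; split; first exact: H1N.
exists (fun n x => F n x * -1); split => [n||].
- by apply: smoothM => //; exact: smooth_cst.
- exact: H1_cvgN.
- by under eq_fun do under eq_integral do rewrite mulrN1 sqrrN.
Qed.

(** Passes from one extended-real integral to real inner products: each square is a summand of the
    nonnegative integrand of [H1_cvg], so its integral is squeezed to 0. *)
Lemma H1_cvg_ip (F : nat -> E -> R) w : (forall n, smooth (F n)) -> H1 Omega w ->
  H1_cvg Omega F w ->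
  ip_s Omega (fun x => F n x - w.1 x) (fun x => F n x - w.1 x) @[n --> \oo] --> 0 /\
  forall i, ip_s Omega (fun x => partial i (F n) x - w.2 i x)
      (fun x => partial i (F n) x - w.2 i x) @[n --> \oo] --> 0.
Proof.
move=> sF [Lw Lgw _] cF; have mO := measurable_Omega oO.
have L0 n : L2 Omega (fun x => F n x - w.1 x).
  by apply: L2B => //; exact/L2_continuous/smooth_continuous.
have L1 n i : L2 Omega (fun x => partial i (F n) x - w.2 i x).
  by apply: L2B => //; exact/L2_continuous/smooth_continuous/smooth_partial.
have squeeze (G : nat -> E -> R) : (forall n, L2 Omega (G n)) ->
    (forall n x, G n x ^+ 2 <= (F n x - w.1 x) ^+ 2 +
      \sum_i (partial i (F n) x - w.2 i x) ^+ 2) ->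
    ip_s Omega (G n) (G n) @[n --> \oo] --> 0.
  move=> LG le; apply: (@fine_cvg _ _ _ _
    (fun n => \int[lebm]_(x in Omega) (G n x * G n x)%:E)%E).
  apply: (@squeeze_cvge _ _ _ _ (cst 0%E) _ _ _ _ _ cF); last exact: cvg_cst.
  apply: nearW => n; apply/andP; split.
    by apply: integral_ge0 => x _; rewrite lee_fin -expr2 sqr_ge0.
  apply: ge0_le_integral; [exact: mO| | | |].
  - by move=> x _; rewrite lee_fin -expr2 sqr_ge0.
  - by have /measurable_int := L2M_integrable oO (LG n) (LG n).
  - apply/measurable_EFinP; apply: measurable_funD.
      by have [mF _] := L0 n; exact: measurable_funX.
    apply: measurable_sum => i.
    by have [mF _] := L1 n i; exact: measurable_funX.
  - by move=> x _; rewrite lee_fin -expr2.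
split=> [|i]; apply: squeeze => // n x.
  by rewrite lerDl sumr_ge0// => i _; rewrite sqr_ge0.
rewrite (bigD1 i)//= addrCA lerDl addr_ge0 ?sqr_ge0// sumr_ge0// => j _.
by rewrite sqr_ge0.
Qed.

(* Testing the weak derivative of [s] against [phi * F n] and letting [F n] tend
   to [s] makes a chain rule for [s ^ 2] unnecessary. *)
Lemma weak_sqr (F : nat -> E -> R) s phi i : test_function Omega phi ->
  (forall n, smooth (F n)) -> H1 Omega s -> H1_cvg Omega F s ->
  \int[lebm]_(x in Omega) (phi x * s.2 i x * s.1 x) +
  2^-1 * \int[lebm]_(x in Omega) (partial i phi x * (s.1 x * s.1 x)) = 0.
Proof.
move=> tphi sF Hs cF; have [cF0 cF1] := H1_cvg_ip sF Hs cF.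
have [Ls Lgs Is] := Hs; have [sphi _] := tphi.
have cphi := smooth_continuous sphi.
have cpphi := smooth_continuous (smooth_partial i sphi).
have LF n := L2_continuous oO bO (smooth_continuous (sF n)).
have LpF n := L2_continuous oO bO (smooth_continuous (smooth_partial i (sF n))).
have Lsphi := L2M_continuous oO bO Ls cphi.
have Lspphi := L2M_continuous oO bO Ls cpphi.
have Lgsphi := L2M_continuous oO bO (Lgs i) cphi.
(* This is the weak derivative of [s] tested against [phi * F n]. Every term is an inner product of
   [F n] or its derivative with a fixed L^2 function, so strong convergence of [F n] suffices for
   the limit. *)
have E0 n : ip_s Omega (partial i (F n)) (fun x => s.1 x * phi x) +
    (ip_s Omega (F n) (fun x => s.1 x * partial i phi x) +
     ip_s Omega (F n) (fun x => s.2 i x * phi x)) = 0.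
  have := Is i _ (test_functionM tphi (sF n)).
  under eq_Rintegral do rewrite partialM//.
  have -> : \int[lebm]_(x in Omega) (s.1 x *
        (phi x * partial i (F n) x + F n x * partial i phi x)) =
      ip_s Omega (partial i (F n)) (fun x => s.1 x * phi x) +
      ip_s Omega (F n) (fun x => s.1 x * partial i phi x).
    rewrite -RintegralD; [|exact: measurable_Omega|exact: L2M_integrable|
      exact: L2M_integrable].
    by apply: eq_Rintegral => x _; ring.
  rewrite addrA => ->; apply/eqP; rewrite addrC subr_eq0; apply/eqP.
  by apply: eq_Rintegral => x _; ring.
have lim0 := ip_s_cvg oO LpF (Lgs i) Lsphi (cF1 i).
have lim1 := ip_s_cvg oO LF Ls Lspphi cF0.
have lim2 := ip_s_cvg oO LF Ls Lgsphi cF0.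
have {lim0 lim1 lim2} : cst (0 : R) n @[n --> \oo] -->
    ip_s Omega (s.2 i) (fun x => s.1 x * phi x) +
    (ip_s Omega s.1 (fun x => s.1 x * partial i phi x) +
     ip_s Omega s.1 (fun x => s.2 i x * phi x)).
  apply: cvg_trans (cvgD lim0 (cvgD lim1 lim2)).
  by apply: near_eq_cvg; apply: nearW => n; exact: E0.
move=> /(cvg_lim (@norm_hausdorff _ _)); rewrite lim_cst//.
(* The limit identity reads [A + (B + A) = 0], twice the claim. *)
set A := (X in _ -> X + _ = _); set B := (X in _ -> _ + _ * X = _).
have -> : ip_s Omega (s.2 i) (fun x => s.1 x * phi x) = A.
  by apply: eq_Rintegral => x _; ring.
have -> : ip_s Omega s.1 (fun x => s.1 x * partial i phi x) = B.
  by apply: eq_Rintegral => x _; ring.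
have -> : ip_s Omega s.1 (fun x => s.2 i x * phi x) = A.
  by apply: eq_Rintegral => x _; ring.
by clearbody A B => AB0; lra.
Qed.

(** Infinite terms cannot cancel in [\bar R], since +oo plus -oo is again infinite; hence a bound on
    the whole form controls each of its two integrals. *)
Lemma fin_numD_half (A B : \bar R) (r : R) : (`|A + 2^-1%:E * B| <= r%:E)%E ->
  A \is a fin_num /\ B \is a fin_num.
Proof.
move=> AB; have : (A + 2^-1%:E * B)%E \is a fin_num.
  by rewrite fin_num_abs (le_lt_trans AB)// ltry.
rewrite fin_numD => /andP[-> fB]; split => //.
by case: B AB fB => [//||] _; rewrite ?gt0_muley ?gt0_muleNy// lte_fin invr_gt0.
Qed.

Lemma Rintegral_sum (I : finType) (F : I -> E -> R) :
  (forall i, lebm.-integrable Omega (EFin \o F i)) ->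
  \int[lebm]_(x in Omega) (\sum_i F i x) = \sum_i \int[lebm]_(x in Omega) F i x.
Proof.
move=> iF; rewrite /Rintegral.
under eq_integral do rewrite -sumEFin.
rewrite (integral_sum (measurable_Omega oO) iF) -sum_fine// => i _.
exact: (integrable_fin_num (measurable_Omega oO) (iF i)).
Qed.

Lemma gnorm_sqr w : H1 Omega w ->
  gnorm_s Omega w ^+ 2 = \sum_i ip_s Omega (w.2 i) (w.2 i).
Proof.
move=> [_ Lw _]; rewrite sqr_sqrtr; last first.
  by apply: Rintegral_ge0 => x _; apply: sumr_ge0 => i _; rewrite -expr2 sqr_ge0.
by rewrite -Rintegral_sum// => i; exact: L2M_integrable.
Qed.

Lemma gnorm_approx_cvg (F : nat -> E -> R) w : (forall n, test_function Omega (F n)) ->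
  H1 Omega w -> H1_cvg Omega F w ->
  gnorm_s Omega (-1 *: smooth_field (F n) + w) @[n --> \oo] --> 0.
Proof.
move=> tF Hw cF; have sF n : smooth (F n) by have [] := tF n.
have [_ cF1] := H1_cvg_ip sF Hw cF.
have e n : gnorm_s Omega (-1 *: smooth_field (F n) + w) =
  Num.sqrt (\sum_i ip_s Omega (fun x => partial i (F n) x - w.2 i x)
                     (fun x => partial i (F n) x - w.2 i x)).
  rewrite -[LHS]ger0_norm ?sqrtr_ge0// -sqrtr_sqr gnorm_sqr; last first.
    by apply: H1_lincomb => //; exact: H1_smooth_field.
  congr Num.sqrt; apply: eq_bigr => i _; apply: eq_Rintegral => x _.
  by rewrite !sfield_lincombE /=; ring.
have := @cvg_big R _ +%R 0 xpredT (@add_continuous _) _ \oo (index_enum 'I_d)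
  _ (fun=> 0) eventually_filter (fun i _ => cF1 i).
rewrite (_ : \sum_(i < d) (0 : R) = 0); last by rewrite big1.
move=> /(continuous_cvg _ (@sqrt_continuous _ 0)); rewrite sqrtr0.
by apply: cvg_trans; apply: near_eq_cvg; apply: nearW => n; exact/esym/e.
Qed.

(* The form vanishes on test functions, which are dense in [H10], but [s ^ 2] is
   only integrable: it is the trilinear bound, and not an L^2 estimate, that
   makes the form continuous in [z]. *)
Lemma skew_scalar (F : nat -> E -> R) i w s (C : R) :
  (forall n, smooth (F n)) -> H1 Omega s -> H1_cvg Omega F s ->
  (forall z, H10 Omega z ->
    `|\int[lebm]_(x in Omega) (z.1 x * s.2 i x * s.1 x)%:E +
      2^-1%:E * \int[lebm]_(x in Omega) (z.2 i x * (s.1 x * s.1 x))%:E|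
    <= (C * gnorm_s Omega z)%:E)%E ->
  H10 Omega w ->
  [/\ lebm.-integrable Omega (EFin \o (fun x => w.1 x * s.2 i x * s.1 x)),
      lebm.-integrable Omega (EFin \o (fun x => w.2 i x * (s.1 x * s.1 x))) &
      \int[lebm]_(x in Omega) (w.1 x * s.2 i x * s.1 x) +
      2^-1 * \int[lebm]_(x in Omega) (w.2 i x * (s.1 x * s.1 x)) = 0].
Proof.
move=> sF Hs cF bound Hw; have mO := measurable_Omega oO.
have [[ms _] [_ Lgs _]] : L2 Omega s.1 /\ H1 Omega s by split => //; case: Hs.
have mgs : measurable_fun (Omega : set (lebT R d)) (s.2 i : lebT R d -> R).
  by have [] := Lgs i.
(* For a measurable integrand, finiteness of the extended integral already means absolute
   integrability. *)
have int z : H10 Omega z ->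
    lebm.-integrable Omega (EFin \o (fun x => z.1 x * s.2 i x * s.1 x)) /\
    lebm.-integrable Omega (EFin \o (fun x => z.2 i x * (s.1 x * s.1 x))).
  move=> Hz; have [[[mz _] Lgz _] _] := Hz; have [mgz _] := Lgz i.
  have [fA fB] := fin_numD_half (bound z Hz).
  have m1 : measurable_fun (Omega : set (lebT R d))
      ((fun x => z.1 x * s.2 i x * s.1 x) : lebT R d -> R).
    exact: (measurable_funM (measurable_funM mz mgs) ms).
  have m2 : measurable_fun (Omega : set (lebT R d))
      ((fun x => z.2 i x * (s.1 x * s.1 x)) : lebT R d -> R).
    exact: (measurable_funM mgz (measurable_funM ms ms)).
  by split; apply/integrableP; (split; first exact/measurable_EFinP);
    rewrite integral_fin_num_abs.
have [intw1 intw2] := int w Hw; split => //.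
pose ell z := \int[lebm]_(x in Omega) (z.1 x * s.2 i x * s.1 x) +
  2^-1 * \int[lebm]_(x in Omega) (z.2 i x * (s.1 x * s.1 x)).
have ell_bound z : H10 Omega z -> `|ell z| <= C * gnorm_s Omega z.
  move=> Hz; have [i1 i2] := int z Hz; rewrite -lee_fin.
  apply: le_trans (bound z Hz); rewrite /ell /Rintegral.
  have f1 := integrable_fin_num mO i1; have f2 := integrable_fin_num mO i2.
  by rewrite -[in leRHS](fineK f1) -[in leRHS](fineK f2).
have [_ [psi [tpsi cpsi]]] := Hw.
(* The form [ell] is linear and vanishes on test functions, so it takes the same value at [w] and at
   its difference with [psi n], whose gradient norm tends to 0. *)
have ellB n : ell (-1 *: smooth_field (psi n) + w) = ell w.
  have Hpsi := H10_smooth_field (tpsi n); have [j1 j2] := int _ Hpsi.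
  have ell0 : ell (smooth_field (psi n)) = 0.
    exact: weak_sqr (tpsi n) sF Hs cF.
  rewrite -[RHS]subr0 -ell0 /ell.
  have -> : \int[lebm]_(x in Omega)
      ((-1 *: smooth_field (psi n) + w).1 x * s.2 i x * s.1 x) =
    \int[lebm]_(x in Omega) (w.1 x * s.2 i x * s.1 x) -
    \int[lebm]_(x in Omega) (psi n x * s.2 i x * s.1 x).
    rewrite -RintegralB//; apply: eq_Rintegral => x _.
    by rewrite sfield_lincombE /=; ring.
  have -> : \int[lebm]_(x in Omega)
      ((-1 *: smooth_field (psi n) + w).2 i x * (s.1 x * s.1 x)) =
    \int[lebm]_(x in Omega) (w.2 i x * (s.1 x * s.1 x)) -
    \int[lebm]_(x in Omega) (partial i (psi n) x * (s.1 x * s.1 x)).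
    rewrite -RintegralB//; apply: eq_Rintegral => x _.
    by rewrite sfield_lincombE /=; ring.
  by rewrite /=; ring.
have lim : C * gnorm_s Omega (-1 *: smooth_field (psi n) + w) @[n --> \oo] --> 0.
  rewrite -(mulr0 C); apply: cvgM; first exact: cvg_cst.
  by have [Hw1 _] := Hw; exact: gnorm_approx_cvg.
apply/eqP; rewrite -normr_le0 -/(ell w).
rewrite -(cvg_lim (@norm_hausdorff _ _) lim).
apply: limr_ge; first exact: cvgP lim.
apply: nearW => n.
by rewrite -(ellB n); apply: ell_bound; exact: H10B_smooth_field.
Qed.

End sobolev.

(** * Skew symmetry of the two trilinear forms *)

Section skew_symmetry.
Context (R : realType) (d : nat) (Omega : set 'rV[R]_d).
Hypotheses (oO : open Omega) (bO : bounded_set Omega).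
Local Notation E := 'rV[R]_d.
Implicit Types (w s : sfield R d) (u v : vfield R d).

(* Fields with a single nonzero component isolate one summand of a trilinear
   form; the bound on the form at general fields controls only the sum. *)
Definition single (i : 'I_d) w : vfield R d := fun j => if j == i then w else 0.

Lemma sum_if_eq (i : 'I_d) (a : 'I_d -> R) :
  \sum_k (if k == i then a k else 0) = a i.
Proof. by rewrite -big_mkcond big_pred1_eq. Qed.

Lemma single_fun i w j x : (single i w j).1 x = if j == i then w.1 x else 0.
Proof. by rewrite /single; case: ifP. Qed.

Lemma single_grad i w j k x :
  (single i w j).2 k x = if j == i then w.2 k x else 0.
Proof. by rewrite /single; case: ifP. Qed.

Lemma div_single i w x : div (single i w) x = w.2 i x.
Proof.
rewrite /div; under eq_bigr do rewrite single_grad.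
exact: (sum_if_eq i (fun k => w.2 k x)).
Qed.

Lemma gnorm_single i w : gnorm_v Omega (single i w) = gnorm_s Omega w.
Proof.
congr Num.sqrt; apply: eq_Rintegral => x _.
rewrite -(sum_if_eq i (fun=> \sum_k w.2 k x * w.2 k x)); apply: eq_bigr => j _.
under eq_bigr do rewrite single_grad.
by case: ifP => // _; rewrite big1// => k _; rewrite mul0r.
Qed.

Lemma H10_0 : H10 Omega 0.
Proof.
have t0 : test_function Omega (fun=> 0).
  split; first exact: smooth_cst.
  by exists set0; split => //; exact: compact0.
have := H10_smooth_field oO bO t0; congr (H10 _ _).
by congr (_, _); apply/funext => i; apply/funext => x; rewrite partial_cst.
Qed.

Lemma X_single i w : H10 Omega w -> X_ Omega (single i w).
Proof. by move=> Hw j; rewrite /single; case: ifP => // _; exact: H10_0. Qed.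

Lemma bhatE_single i w s t :
  bhatE Omega (single i w) s t =
  (\int[lebm]_(x in Omega) (w.1 x * s.2 i x * t.1 x)%:E +
   2^-1%:E * \int[lebm]_(x in Omega) (w.2 i x * (s.1 x * t.1 x))%:E)%E.
Proof.
congr (_ + _ * _)%E; apply: eq_integral => x _; congr (_%:E).
  under eq_bigr do rewrite single_fun.
  rewrite -(sum_if_eq i (fun k => w.1 x * s.2 k x)); congr (_ * _).
  by apply: eq_bigr => k _; case: ifP => // _; rewrite mul0r.
by rewrite div_single.
Qed.

(** The right-hand side is the one of [bhatE_single], so [skew_scalar] serves both forms. *)
Lemma bE_single i j w s t :
  bE Omega (single i w) (single j s) (single j t) =
  (\int[lebm]_(x in Omega) (w.1 x * s.2 i x * t.1 x)%:E +
   2^-1%:E * \int[lebm]_(x in Omega) (w.2 i x * (s.1 x * t.1 x))%:E)%E.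
Proof.
rewrite -bhatE_single; congr (_ + _ * _)%E; apply: eq_integral => x _; congr (_%:E).
  rewrite -(sum_if_eq j (fun=> (\sum_k (single i w k).1 x * s.2 k x) * t.1 x)).
  apply: eq_bigr => l _; rewrite [(single j t l).1 x]single_fun.
  under eq_bigr do rewrite [(single j s l).2 _ x]single_grad.
  by case: ifP => // _; rewrite mulr0.
congr (_ * _); rewrite -(sum_if_eq j (fun=> s.1 x * t.1 x)).
by apply: eq_bigr => l _; rewrite !single_fun; case: ifP => // _; rewrite mul0r.
Qed.

(** Integrability of every summand is what allows the finite sum to leave the extended integral and
    [fine] to be harmless. *)
Lemma skew_sum (I : finType) (A B : I -> E -> R) (a c : E -> R) :
  (forall k, [/\ lebm.-integrable Omega (EFin \o A k),
     lebm.-integrable Omega (EFin \o B k) &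
     \int[lebm]_(x in Omega) A k x + 2^-1 * \int[lebm]_(x in Omega) B k x = 0]) ->
  (forall x, a x = \sum_k A k x) -> (forall x, c x = \sum_k B k x) ->
  fine (\int[lebm]_(x in Omega) (a x)%:E +
        2^-1%:E * \int[lebm]_(x in Omega) (c x)%:E)%E = 0.
Proof.
move=> AB /funext -> /funext ->; have mO := measurable_Omega oO.
have sumI (F : I -> E -> R) : (forall k, lebm.-integrable Omega (EFin \o F k)) ->
    (\int[lebm]_(x in Omega) (\sum_k F k x)%:E)%E =
    (\sum_k \int[lebm]_(x in Omega) F k x)%:E.
  move=> iF; rewrite -Rintegral_sum// fineK//; apply: (integrable_fin_num mO).
  have := integrable_sum mO (index_enum I) (P := xpredT) (fun k _ => iF k).
  by apply: eq_integrable => // x _ /=; rewrite sumEFin.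
rewrite !sumI; [|by move=> k; have [] := AB k|by move=> k; have [] := AB k].
rewrite -EFinM -EFinD /= mulr_sumr -big_split /= big1// => k _.
by have [_ _] := AB k.
Qed.

Lemma bhat_skew Gamma (C : R) u s :
  (forall u (s t : sfield R d), X_ Omega u -> D_ Omega Gamma s -> D_ Omega Gamma t ->
     (`|bhatE Omega u s t| <=
        (C * gnorm_v Omega u * gnorm_s Omega s * gnorm_s Omega t)%:E)%E) ->
  X_ Omega u -> D_ Omega Gamma s -> bhat Omega u s s = 0.
Proof.
move=> bound Xu Ds; have [Hs [F [sF cF _]]] := Ds.
apply: (skew_sum (A := fun i x => (u i).1 x * s.2 i x * s.1 x)
                 (B := fun i x => (u i).2 i x * (s.1 x * s.1 x))).
(* With [s] fixed, its gradient norms are absorbed in the constant, leaving a bound linear in the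
   gradient norm of [z]. *)
- move=> i; apply: (skew_scalar oO bO
    (C := C * gnorm_s Omega s * gnorm_s Omega s) sF Hs cF _ (Xu i)) => z Hz.
  rewrite -bhatE_single; apply: (le_trans (bound _ _ _ (X_single i Hz) Ds Ds)).
  by rewrite gnorm_single lee_fin le_eqVlt; apply/orP; left; apply/eqP; ring.
- by move=> x; rewrite mulr_suml.
- by move=> x; rewrite mulr_suml.
Qed.

(** The double sum is indexed by pairs: [p.1] is the component of [v], [p.2] the direction of
    differentiation. Each pair is a scalar identity. *)
Lemma b_skew (C : R) u v :
  (forall u v w : vfield R d, X_ Omega u -> X_ Omega v -> X_ Omega w ->
     (`|bE Omega u v w| <=
        (C * gnorm_v Omega u * gnorm_v Omega v * gnorm_v Omega w)%:E)%E) ->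
  X_ Omega u -> X_ Omega v -> b Omega u v v = 0.
Proof.
move=> bound Xu Xv.
apply: (skew_sum
  (A := fun p : 'I_d * 'I_d => fun x => (u p.2).1 x * (v p.1).2 p.2 x * (v p.1).1 x)
  (B := fun p : 'I_d * 'I_d => fun x => (u p.2).2 p.2 x * ((v p.1).1 x * (v p.1).1 x))).
- move=> [j i]/=; have [Hv [F [tF cF]]] := Xv j.
  have sF n : smooth (F n) by have [] := tF n.
  apply: (skew_scalar oO bO
    (C := C * gnorm_s Omega (v j) * gnorm_s Omega (v j)) sF Hv cF _ (Xu i)) => z Hz.
  rewrite -(bE_single i j); apply: (le_trans (bound _ _ _ (X_single i Hz)
    (X_single j (Xv j)) (X_single j (Xv j)))).
  by rewrite !gnorm_single lee_fin le_eqVlt; apply/orP; left; apply/eqP; ring.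
- move=> x; rewrite -(pair_bigA _ (fun j i => (u i).1 x * (v j).2 i x * (v j).1 x)) /=.
  by apply: eq_bigr => j _; rewrite mulr_suml.
- move=> x; rewrite -(pair_bigA _ (fun j i => (u i).2 i x * ((v j).1 x * (v j).1 x))) /=.
  by rewrite exchange_big /= /div mulr_suml; apply: eq_bigr => i _; rewrite mulr_sumr.
Qed.

End skew_symmetry.

(** * Energy estimates *)

Section energy_bounds.
Context (R : realType) (d : nat) (Omega : set 'rV[R]_d).
Hypotheses (oO : open Omega) (bO : bounded_set Omega).
Local Notation E := 'rV[R]_d.
Implicit Types (s T : sfield R d) (v : vfield R d).

Lemma gnorm_sN s : gnorm_s Omega (- s) = gnorm_s Omega s.
Proof.
congr Num.sqrt; apply: eq_Rintegral => x _.
by apply: eq_bigr => i _; rewrite sfieldNE mulrNN.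
Qed.

Lemma gnorm_vN v : gnorm_v Omega (- v) = gnorm_v Omega v.
Proof.
congr Num.sqrt; apply: eq_Rintegral => x _; apply: eq_bigr => j _.
by apply: eq_bigr => i _; rewrite [(- v) j]/(- v j) sfieldNE mulrNN.
Qed.

Lemma V_N v : V_ Omega v -> V_ Omega (- v).
Proof.
move=> [Xv divv]; split=> [j|q Qq]; first exact: (H10N oO bO (Xv j)).
(* Square integrability of the divergence makes its product with [q] integrable, so that the sign
   can be taken out of the integral. *)
have Ldiv : L2 Omega (div v).
  rewrite /div; elim: (index_enum _) => [|i r IHr].
    rewrite (_ : (fun x => _) = fun=> 0).
      exact/(L2_continuous oO bO)/cst_continuous.
    by apply/funext => x; rewrite big_nil.
  rewrite (_ : (fun x => _) =
      fun x => 1 * (v i).2 i x + \sum_(k <- r) (v k).2 k x).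
    by apply: L2_lincomb => //; have [[_ + _] _] := Xv i; apply.
  by apply/funext => x; rewrite big_cons mul1r.
rewrite -[RHS](mulr0 (-1)) -(divv q Qq) -RintegralZl.
- apply: eq_Rintegral => x _; rewrite mulrA mulN1r; congr (_ * _).
  by rewrite /div -sumrN; apply: eq_bigr => i _; rewrite [(- v) i]/(- v i) sfieldNE.
- exact: measurable_Omega.
- by have [Lq _] := Qq; exact: L2M_integrable.
Qed.

Lemma gnorm_v_sqr v : ip_grad_v Omega v v = gnorm_v Omega v ^+ 2.
Proof.
rewrite sqr_sqrtr//; apply: Rintegral_ge0 => x _; apply: sumr_ge0 => j _.
by apply: sumr_ge0 => i _; rewrite -expr2 sqr_ge0.
Qed.

Lemma gnorm_s_sqr s : ip_grad_s Omega s s = gnorm_s Omega s ^+ 2.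
Proof.
rewrite sqr_sqrtr//; apply: Rintegral_ge0 => x _.
by apply: sumr_ge0 => i _; rewrite -expr2 sqr_ge0.
Qed.

Lemma norm_component_le v j : (forall k, L2 Omega (v k).1) ->
  Num.sqrt (ip_s Omega (v j).1 (v j).1) <= norm_v Omega v.
Proof.
move=> Lv; rewrite ler_wsqrtr// /ip_v Rintegral_sum//; last first.
  by move=> k; exact: (L2M_integrable oO (Lv k) (Lv k)).
by rewrite (bigD1 j)//= lerDl sumr_ge0// => k _; exact: ip_s_ge0.
Qed.

(** Only the component of index [d.-1] survives in the inner product, and its norm is at most that
    of the whole field. *)
Lemma ip_last_component_le T v : (0 < d)%N -> L2 Omega T.1 ->
  (forall j, L2 Omega (v j).1) ->
  `|ip_v Omega (last_component T) (values v)| <= norm_s Omega T * norm_v Omega v.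
Proof.
move=> d0 LT Lv; have ld : (d.-1 < d)%N by rewrite prednK.
pose l := Ordinal ld.
have -> : ip_v Omega (last_component T) (values v) = ip_s Omega T.1 (v l).1.
  apply: eq_Rintegral => x _; rewrite -(sum_if_eq l (fun j => T.1 x * (v j).1 x)).
  apply: eq_bigr => j _; rewrite /last_component /values.
  rewrite (_ : (j.+1 == d) = (j == l)); first by case: ifP => // _; rewrite mul0r.
  by rewrite -val_eqE /= -(eqSS j d.-1) prednK.
apply: (le_trans (ip_s_CauchySchwarz oO LT (Lv l))).
by rewrite ler_wpM2l ?sqrtr_ge0// norm_component_le.
Qed.

End energy_bounds.

(** * Dual norms and the real inequalities behind the estimate *)

Section dual_norm.
Context (R : realType) (U : lmodType R) (S : set U) (N F : U -> R) (C : R).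
Hypotheses (N_ge0 : forall z, S z -> 0 <= N z)
  (FC : forall z, S z -> `|F z| <= C * N z).

Lemma le_dual_norm z : S z -> F z <= dual_norm S N F * N z.
Proof.
move=> Sz; have Fz := FC Sz.
(* Elements with [N z = 0] are left out of the supremum; there [FC] forces [F z] to be 0. *)
have [Nz0|Nz0] := eqVneq (N z) 0.
  by move: Fz; rewrite Nz0 !mulr0; exact/le_trans/ler_norm.
rewrite -ler_pdivrMr; last by rewrite lt0r Nz0 N_ge0.
(* Without the bound [C], [sup] would be a default value and bound nothing. *)
apply: sup_upper_bound; last by exists z.
split; first by exists (F z / N z), z.
exists C => _ [y [/= Sy Ny0] <-].
rewrite ler_pdivrMr; last by rewrite lt0r Ny0 N_ge0.
exact: le_trans (ler_norm _) (FC Sy).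
Qed.

(** The bound at [z] and at [- z] gives [F z] and its opposite at most the dual norm times [N z]. If
    no [z] has nonzero norm, the supremum is that of the empty set, which is 0. *)
Lemma dual_norm_ge0 : (forall z, S z -> S (- z)) -> (forall z, N (- z) = N z) ->
  (forall z, S z -> F (- z) = - F z) -> 0 <= dual_norm S N F.
Proof.
move=> SN NN FN; have [[z [Sz Nz]]|S0] := pselect (exists z, S z /\ N z != 0).
  have Nz0 : 0 < N z by rewrite lt0r Nz N_ge0.
  rewrite -(pmulr_lge0 _ Nz0).
  have := le_dual_norm Sz; have := le_dual_norm (SN _ Sz).
  by rewrite FN// NN => h1 h2; lra.
rewrite /dual_norm (_ : [set _ | _ in _] = set0) ?sup0// -subset0.
by move=> y [z Sz _]; apply: S0; exists z.
Qed.

End dual_norm.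

Lemma in_dual_N (R : realType) (U : lmodType R) (S : set U) (N F : U -> R) z :
  in_dual S N F -> S z -> F (- z) = - F z.
Proof.
move=> [lin _] Sz; have -> : - z = -2 *: z + z.
  by rewrite scaleNr scaler_nat mulr2n opprD addrNK.
by rewrite lin//; ring.
Qed.

Lemma quadratic_le (R : realDomainType) (c x B : R) :
  0 <= x -> 0 <= B -> c * x ^+ 2 <= B * x -> c * x <= B.
Proof.
rewrite le0r => /orP[/eqP ->|x0] B0; first by move=> _; rewrite mulr0.
by rewrite expr2 mulrA ler_pM2r.
Qed.

Lemma fine_abse_le (R : realType) (x : \bar R) (r : R) :
  (`|x| <= r%:E)%E -> `|fine x| <= r.
Proof.
case: x => [x||] xr; [by rewrite -lee_fin| |];
  by have := le_lt_trans xr (ltry r); rewrite ltxx.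
Qed.

(** Here [x], [y] are the velocity and temperature gradient norms of the Picard iterate and [X], [Y]
    those of the Newton iterate. Cancelling one factor in each energy inequality gives [y <= M2],
    [x <= M1] and the bounds [YB] and [XB]. *)
Lemma picard_newton_bound (R : realFieldType)
  (Cs Cp nu kappa Ri F G M1 M2 alpha1 alpha2 x y X Y : R) :
  0 <= Cs -> 0 < nu -> 0 < kappa -> 0 <= Ri -> 0 <= F -> 0 <= G ->
  0 <= x -> 0 <= y -> 0 <= X -> 0 <= Y ->
  M2 = kappa^-1 * G -> M1 = nu^-1 * F + Ri * Cp ^+ 2 * nu^-1 * M2 ->
  alpha1 = Cs * nu^-1 * M1 -> alpha2 = Cs * kappa^-1 * M2 ->
  alpha1 + alpha2 < 1 ->
  kappa * y ^+ 2 <= G * y ->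
  nu * x ^+ 2 <= (F + Ri * Cp ^+ 2 * y) * x ->
  kappa * Y ^+ 2 <= (G + Cs * x * y + Cs * X * y) * Y ->
  nu * X ^+ 2 <= (F + Ri * Cp ^+ 2 * Y + Cs * x * x + Cs * X * x) * X ->
  (1 - alpha1 - alpha2) * X + (1 - nu^-1 * Ri * Cp ^+ 2) * Y <= M2 + 2 * M1.
Proof.
move=> Cs0 nu0 ka0 Ri0 F0 G0 x0 y0 X0 Y0 M2E M1E a1E a2E a_lt1.
have [nu_neq0 ka_neq0] : nu != 0 /\ kappa != 0 by rewrite !gt_eqF.
have Cp0 : 0 <= Cp ^+ 2 by exact: sqr_ge0.
have r0 : 0 <= Ri * Cp ^+ 2 by rewrite mulr_ge0.
have M20 : 0 <= M2 by rewrite M2E mulr_ge0// invr_ge0 ltW.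
have nuF0 : 0 <= nu^-1 * F by rewrite mulr_ge0// invr_ge0 ltW.
have FM1 : nu^-1 * F <= M1.
  by rewrite M1E lerDl mulr_ge0// mulr_ge0// invr_ge0 ltW.
have M10 : 0 <= M1 by exact: le_trans FM1.
have kM2 : kappa * M2 = G by rewrite M2E; field.
have nM1 : nu * M1 = F + Ri * Cp ^+ 2 * M2 by rewrite M1E; field.
move=> /(quadratic_le y0 G0); rewrite -[X in _ <= X -> _]kM2 ler_pM2l// => yM2.
move=> /(quadratic_le x0) h; have {h} : nu * x <= nu * M1.
  rewrite nM1; apply: (le_trans (h (addr_ge0 F0 (mulr_ge0 r0 y0)))).
  by rewrite lerD2l ler_wpM2l.
rewrite ler_pM2l// => xM1.
move=> /(quadratic_le Y0) h; have {h} :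
    kappa * Y <= kappa * (M2 + alpha2 * M1 + alpha2 * X).
  have /h : 0 <= G + Cs * x * y + Cs * X * y by rewrite !addr_ge0 ?mulr_ge0.
  move=> /le_trans; apply; rewrite -kM2.
  (* By definition of [alpha2], [Cs * M2 = kappa * alpha2]; thus the convection terms are bounded
     after replacing [x] by [M1] and [y] by [M2]. *)
  rewrite (_ : kappa * (_ + _) = kappa * M2 + Cs * M1 * M2 + Cs * X * M2); last first.
    by rewrite a2E; field.
  by rewrite !lerD// ?ler_pM ?ler_wpM2l ?mulr_ge0.
rewrite ler_pM2l// => YB.
move=> /(quadratic_le X0) h.
have {h} : nu * X <=
    nu * (nu^-1 * F + nu^-1 * Ri * Cp ^+ 2 * Y + alpha1 * M1 + alpha1 * X).
  have /h : 0 <= F + Ri * Cp ^+ 2 * Y + Cs * x * x + Cs * X * x.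
    by rewrite !addr_ge0 ?(mulr_ge0 r0)// !mulr_ge0.
  move=> /le_trans; apply.
  rewrite (_ : nu * (_ + _) =
    F + Ri * Cp ^+ 2 * Y + Cs * M1 * M1 + Cs * X * M1); last first.
    by rewrite a1E; field.
  by rewrite !lerD// ?ler_pM ?ler_wpM2l ?mulr_ge0.
rewrite ler_pM2l// => XB.
(* In the sum of [XB] and [YB], the remaining constants are [M2], [nu^-1 * F] and
   [(alpha1 + alpha2) * M1]; each of the last two is at most [M1]. *)
have : (alpha1 + alpha2) * M1 <= M1 by rewrite ler_piMl// ltW.
move: XB YB FM1; move: (nu^-1 * F) (nu^-1 * Ri * Cp ^+ 2) => F' r.
by move=> *; nra.
Qed.

Theorem theorem3p2 (R : realType) (d : nat) (Omega Gamma1 Gamma2 : set 'rV[R]_d)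
  (hd : d = 2%N \/ d = 3%N)
  (Omega_open : open Omega) (Omega_neq0 : Omega !=set0)
  (Omega_connected : connected Omega) (Omega_bounded : bounded_set Omega)
  (boundaryE : closure Omega `\` Omega = Gamma1 `|` Gamma2)
  (Gamma12_null : surf (Gamma1 `&` Gamma2) = 0%E)
  (Gamma1_pos : (0 < surf Gamma1)%E)
  (Cp Cs : R) (Cp_gt0 : 0 < Cp) (Cs_gt0 : 0 < Cs)
  (poincareX : forall z : vfield R d, X_ Omega z ->
     norm_v Omega z <= Cp * gnorm_v Omega z)
  (poincareD : forall z : sfield R d, D_ Omega Gamma1 z ->
     norm_s Omega z <= Cp * gnorm_s Omega z)
  (b_bound : forall u v w : vfield R d,
     X_ Omega u -> X_ Omega v -> X_ Omega w ->
     (`|bE Omega u v w| <=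
        (Cs * gnorm_v Omega u * gnorm_v Omega v * gnorm_v Omega w)%:E)%E)
  (bhat_bound : forall (u : vfield R d) (s t : sfield R d),
     X_ Omega u -> D_ Omega Gamma1 s -> D_ Omega Gamma1 t ->
     (`|bhatE Omega u s t| <=
        (Cs * gnorm_v Omega u * gnorm_s Omega s * gnorm_s Omega t)%:E)%E)
  (nu kappa Ri : R) (nu_gt0 : 0 < nu) (kappa_gt0 : 0 < kappa) (Ri_gt0 : 0 < Ri)
  (f : vfield R d -> R) (g : sfield R d -> R)
  (f_dual : in_dual (X_ Omega) (gnorm_v Omega) f)
  (g_dual : in_dual (D_ Omega Gamma1) (gnorm_s Omega) g)
  (M1 M2 alpha1 alpha2 : R)
  (M2E : M2 = kappa^-1 * dual_norm (D_ Omega Gamma1) (gnorm_s Omega) g)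
  (M1E : M1 = nu^-1 * dual_norm (V_ Omega) (gnorm_v Omega) f
              + Ri * Cp ^+ 2 * nu^-1 * M2)
  (alpha1E : alpha1 = Cs * nu^-1 * M1)
  (alpha2E : alpha2 = Cs * kappa^-1 * M2)
  (alpha_lt1 : alpha1 + alpha2 < 1)
  (Ri_small : nu^-1 * Ri * Cp ^+ 2 < 1)
  (u ut : nat -> vfield R d) (T Tt : nat -> sfield R d)
  (u0_X : X_ Omega (u 0%N))
  (picard : forall k,
     picard_step Omega Gamma1 nu kappa Ri f g (u k) (ut k.+1) (Tt k.+1))
  (newton : forall k,
     newton_step Omega Gamma1 nu kappa Ri f g (ut k.+1) (Tt k.+1)
       (u k.+1) (T k.+1)) :
  forall k : nat,
    (1 - alpha1 - alpha2) * gnorm_v Omega (u k.+1)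
    + (1 - nu^-1 * Ri * Cp ^+ 2) * gnorm_s Omega (T k.+1)
    <= M2 + 2 * M1.

Proof.
move=> k.
have d0 : (0 < d)%N by case: hd => ->.
have [oO bO] := (Omega_open, Omega_bounded).
have [Vut DTt eqP_] := picard k; have [Vu DT eqN] := newton k.
have [[Xut _] [Xu _]] := (Vut, Vu).
(* The initial velocity is only in [X_]; every later one is in [V_], hence in [X_]. *)
have Xuk : X_ Omega (u k) by case: (k) => [//|m]; have [[]] := newton m.
have [HTt HT] : H1 Omega (Tt k.+1) /\ H1 Omega (T k.+1).
  by split; [case: DTt|case: DT].
have bs := b_skew oO bO b_bound; have bhs := bhat_skew oO bO bhat_bound.
have b_le x y z : X_ Omega x -> X_ Omega y -> X_ Omega z ->
    `|b Omega x y z| <= Cs * gnorm_v Omega x * gnorm_v Omega y * gnorm_v Omega z.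
  by move=> Xx Xy Xz; exact/fine_abse_le/b_bound.
have bhat_le x s t : X_ Omega x -> D_ Omega Gamma1 s -> D_ Omega Gamma1 t ->
    `|bhat Omega x s t| <= Cs * gnorm_v Omega x * gnorm_s Omega s * gnorm_s Omega t.
  by move=> Xx Ds Dt; exact/fine_abse_le/bhat_bound.
have buoyancy s v : D_ Omega Gamma1 s -> X_ Omega v ->
    ip_v Omega (last_component s) (values v) <=
    Cp ^+ 2 * gnorm_s Omega s * gnorm_v Omega v.
  move=> Ds Xv; apply: (le_trans (ler_norm _)).
  have Ls : L2 Omega s.1 by case: Ds => -[].
  have Lv j : L2 Omega (v j).1 by have [[]] := Xv j.
  apply: (le_trans (ip_last_component_le oO d0 Ls Lv)).
  (* One Poincare constant comes from the temperature and one from the velocity, whence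
     [Cp ^+ 2]. *)
  apply: (@le_trans _ _ ((Cp * gnorm_s Omega s) * (Cp * gnorm_v Omega v))).
    by apply: ler_pM; rewrite ?sqrtr_ge0 ?poincareD ?poincareX.
  by rewrite le_eqVlt; apply/orP; left; apply/eqP; ring.
have [_ [Cf f_le]] := f_dual; have [_ [Cg g_le]] := g_dual.
have fV_le z : V_ Omega z -> `|f z| <= Cf * gnorm_v Omega z.
  by move=> [Xz _]; exact: f_le.
have fV z : V_ Omega z ->
    f z <= dual_norm (V_ Omega) (gnorm_v Omega) f * gnorm_v Omega z.
  by move=> Vz; apply: (le_dual_norm _ fV_le Vz) => *; exact: sqrtr_ge0.
have gD z : D_ Omega Gamma1 z ->
    g z <= dual_norm (D_ Omega Gamma1) (gnorm_s Omega) g * gnorm_s Omega z.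
  by move=> Dz; apply: (le_dual_norm _ g_le Dz) => *; exact: sqrtr_ge0.
have Fd0 : 0 <= dual_norm (V_ Omega) (gnorm_v Omega) f.
  apply: (dual_norm_ge0 _ fV_le) => [z _|z|z|z [Xz _]].
  - exact: sqrtr_ge0.
  - exact: V_N.
  - exact: gnorm_vN.
  - exact: in_dual_N f_dual Xz.
have Gd0 : 0 <= dual_norm (D_ Omega Gamma1) (gnorm_s Omega) g.
  apply: (dual_norm_ge0 _ g_le) => [z _|z|z|z Dz].
  - exact: sqrtr_ge0.
  - exact: D_N.
  - exact: gnorm_sN.
  - exact: in_dual_N g_dual Dz.
have [e1 e2] := eqP_ _ _ Vut DTt; have [e3 e4] := eqN _ _ Vu DT.
move: e1 e2 e3 e4.
(* Both Picard convection terms vanish, as do the Newton ones advected by [ut k.+1] and acting on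
   the new iterate. The terms where the Picard iterate is differentiated remain, to be bounded by
   [b_le] and [bhat_le]. *)
rewrite bs// bhs// [b Omega (ut k.+1) (u k.+1) _]bs//
  [bhat Omega (ut k.+1) (T k.+1) _]bhs//.
rewrite !gnorm_v_sqr !gnorm_s_sqr !add0r !addr0.
have := fV _ Vut; have := fV _ Vu; have := gD _ DTt; have := gD _ DT.
have := buoyancy _ _ DTt Xut; have := buoyancy _ _ DT Xu.
have := b_le _ _ _ Xu Xut Xu; have := b_le _ _ _ Xut Xut Xu.
have := bhat_le _ _ _ Xu DTt DT; have := bhat_le _ _ _ Xut DTt DT.
(* Upper bounds serve the convection terms on the right of the Newton equations, lower bounds those
   on the left. *)
rewrite !ler_norml => /andP[_ h1] /andP[h2 _] /andP[_ h3] /andP[h4 _].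
move=> h5 h6 h7 h8 h9 h10 e1 e2 e3 e4.
have scale_le p q r : p <= q * r -> Ri * p <= Ri * q * r.
  by move=> /(ler_wpM2l (ltW Ri_gt0)); rewrite mulrA.
apply: (picard_newton_bound (ltW Cs_gt0) nu_gt0 kappa_gt0 (ltW Ri_gt0) Fd0 Gd0
  (sqrtr_ge0 _) (sqrtr_ge0 _) (sqrtr_ge0 _) (sqrtr_ge0 _) M2E M1E alpha1E alpha2E
  alpha_lt1 (x := gnorm_v Omega (ut k.+1)) (y := gnorm_s Omega (Tt k.+1))
  (X := gnorm_v Omega (u k.+1)) (Y := gnorm_s Omega (T k.+1))).
- by rewrite e2.
- move: h6 => /scale_le; rewrite e1 mulrDl mulrA; exact: lerD.
- rewrite !mulrDl; lra.
- move: h5 => /scale_le; rewrite !mulrDl mulrA; lra.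
Qed.
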